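(* Let $Q\subset\mathbb{R}$ be an interval. There is a function $C:[0,1)\to[1,\infty)$ such that for every $\varphi\in\mathrm{BMO}(Q)$ with $\|\varphi\|=\|\varphi\|_{\mathrm{BMO}(Q)}<1$, $$\big\langle e^{|\varphi-\langle\varphi\rangle_Q|}\big\rangle_Q\le C(\|\varphi\|).$$ The bound $1$ on $\|\varphi\|_{\mathrm{BMO}(Q)}$ is sharp, in the sense that there exist functions $\varphi\in\mathrm{BMO}(Q)$ with $\|\varphi\|_{\mathrm{BMO}(Q)}=1$ for which the inequality fails, i.e. $\langle e^{|\varphi-\langle\varphi\rangle_Q|}\rangle_Q=\infty$. Moreover, the best (smallest) value of $C(\|\varphi\|)$, i.e. for $\varepsilon\in[0,1)$ the number $C(\varepsilon)=\sup\{\langle e^{|\varphi-\langle\varphi\rangle_Q|}\rangle_Q:\ \varphi\in\mathrm{BMO}(Q),\ \|\varphi\|_{\mathrm{BMO}(Q)}=\varepsilon\}$, satisfies $$\frac{1-\frac{\varepsilon}2}{1-\varepsilon}\le C(\varepsilon)\le\frac{1-\frac{\varepsilon^2}2}{1-\varepsilon}.$$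
   Context: ''Interval'' means a bounded interval of positive length in $\mathbb{R}$; functions are real-valued. For an interval $J$, $\langle\varphi\rangle_J=\frac1{|J|}\int_J\varphi$. For an interval $Q$, $\mathrm{BMO}(Q)$ is the set of $\varphi\in L^1(Q)$ such that $\|\varphi\|_{\mathrm{BMO}(Q)}=\sup_{J\subset Q}\big(\langle\varphi^2\rangle_J-\langle\varphi\rangle_J^2\big)^{1/2}<\infty$, the supremum being over all subintervals $J$ of $Q$. *)

(* Defs.v *)
(* A function on an interval Q is represented by a total function R -> R of which
   only the restriction to Q matters. *)
From HB Require Import structures.
From mathcomp Require Import all_boot all_order all_algebra.
From mathcomp Require Import all_classical all_reals all_analysis.

Set Implicit Arguments.
Unset Strict Implicit.
Unset Printing Implicit Defensive.

Import Order.TTheory GRing.Theory Num.Theory.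
Import numFieldNormedType.Exports.

Local Open Scope classical_set_scope.
Local Open Scope ring_scope.
Local Open Scope ereal_scope.

(* Endpoints may or may not belong to J. *)
Definition bdd_interval (R : realType) (J : set R) : Prop :=
  [/\ is_interval J, bounded_set J & 0 < lebesgue_measure J].

Definition avg (R : realType) (J : set R) (f : R -> R) : \bar R :=
  (lebesgue_measure J)^-1 * \int[lebesgue_measure]_(x in J) (f x)%:E.

(* The difference is never of the form +oo - +oo for phi integrable on J: the
   subtracted term is then finite, while the first one may be +oo. *)
Definition mean_oscillation (R : realType) (J : set R) (phi : R -> R) : \bar R :=
  sqrte (avg J (fun x => phi x ^+ 2)%R - (avg J phi) ^+ 2).

Definition bmo_norm (R : realType) (Q : set R) (phi : R -> R) : \bar R :=
  ereal_sup [set mean_oscillation J phi |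
              J in [set J | bdd_interval J /\ J `<=` Q]].

Definition BMO (R : realType) (Q : set R) : set (R -> R) :=
  [set phi | lebesgue_measure.-integrable Q (EFin \o phi) /\
             bmo_norm Q phi < +oo].

(* Extended-real valued, as the integral may diverge; the mean of phi over Q is
   finite for phi integrable on Q, so that [fine] loses nothing. *)
Definition exp_avg (R : realType) (Q : set R) (phi : R -> R) : \bar R :=
  avg Q (fun x => expR `|phi x - fine (avg Q phi)|)%R.

Definition best_const (R : realType) (Q : set R) (eps : R) : \bar R :=
  ereal_sup [set exp_avg Q phi |
              phi in [set phi | BMO Q phi /\ bmo_norm Q phi = eps%:E]].

(* Main.v *)
Require Import Defs.
From HB Require Import structures.
From mathcomp Require Import all_boot all_order all_algebra.
From mathcomp Require Import all_classical all_reals all_analysis.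
From mathcomp Require Import measurable_realfun lra.

(** Upper bound.  Let phi have mean 0 and norm at most eps < 1 on Q.  The heart
of the matter is an inequality for the excess p = (phi - beta)_+ of phi over a
level beta >= 0:
  int_Q p^2 <= 2 eps int_Q p                                     [excess_le].
To see why it holds, put alpha = beta + eps, which is at least the mean of phi
over Q.  Suppose that Q consists of intervals J on which phi has mean exactly
alpha, and of a rest on which phi <= alpha almost everywhere.  The function
h = p^2 - 2 eps p satisfies h <= (phi - alpha)^2 - eps^2 everywhere, so its
integral over each J is at most |J| (Var_J phi - eps^2) <= 0, and h <= 0
wherever phi <= alpha, so the rest does not contribute either.  Such intervals
are usually provided by the rising sun lemma; here [bisection_le] replaces it:
an interval of mean at most alpha is halved, and if this produces a half of
mean larger than alpha, then the intermediate value theorem moves the cut to a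
point at which the mean is exactly alpha.

Multiplying by e^beta and integrating over beta >= 0 turns the excess
inequality into
  (1 - eps) int_Q (e^{phi_+} - 1 - phi_+) <= 1/2 int_Q phi_+^2
[exp_pos_part_le_bounded].  Adding the same inequality for - phi, together
with int_Q phi^2 <= eps^2 |Q| and int_Q |phi| <= eps |Q|, bounds the mean of
e^|phi| by 1 + eps + eps^2 / (2 (1 - eps)) = (1 - eps^2 / 2) / (1 - eps)
[exp_abs_le].

Lower bound and sharpness.  For Q with endpoints a < b and L = (b - a) / 4 take
  phi_t (x) = t (log_+ (L / (x - a)) - log_+ (L / (b - x))).
Half of the mass of Q sits at the value 0, and each outer quarter carries an
exponential tail of scale t; hence the mean of e^|phi_t| is
1/2 + 1/2 (1 - t)^-1 for t < 1 and infinite for t = 1.  The norm of phi_t is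
exactly t.  The variance over Q itself is t^2.  An interval that misses one of
the outer quarters sees a contraction of t log, and the variance of log over
an interval (c, d) of the positive half-line is
1 - c d (log d - log c)^2 / (d - c)^2 [ln_osc].  On an interval J that meets
both outer quarters already int_J phi_1^2 <= |J| [two_sided_log_osc]. *)

Set Implicit Arguments.
Unset Strict Implicit.
Unset Printing Implicit Defensive.

Import Order.TTheory GRing.Theory Num.Theory.
Import numFieldNormedType.Exports.

Local Open Scope classical_set_scope.
Local Open Scope ring_scope.

Local Notation mu := lebesgue_measure.

(** * Integrals over segments *)

Section SegmentIntegral.
Context {R : realType}.
Implicit Types (a b c d : R) (f g : R -> R).

Lemma Rintegral_seg_cst a b k : a <= b ->
  \int[mu]_(x in `[a, b]) k = k * (b - a) :> R.
Proof.
move=> ab; rewrite Rintegral_cst//; congr (_ * _).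
move: ab; rewrite le_eqVlt /= lebesgue_measure_itv /= lte_fin => /predU1P[->|->//].
by rewrite ltxx subrr.
Qed.

Lemma integrable_cst_seg a b (k : R) : mu.-integrable (`[a, b] : set R) (EFin \o cst k).
Proof.
by apply: continuous_compact_integrable; [exact: segment_compact|
  apply: continuous_subspaceT => x; exact: cst_continuous].
Qed.

Lemma integrable_seg_sub a b c d f : a <= c -> d <= b ->
  mu.-integrable (`[a, b] : set R) (EFin \o f) ->
  mu.-integrable (`[c, d] : set R) (EFin \o f).
Proof.
move=> ac db; apply: integrableS => //.
by apply: subset_itv; rewrite bnd_simp.
Qed.

Lemma Rintegral_seg_split a c b f : a <= c -> c <= b ->
  mu.-integrable (`[a, b] : set R) (EFin \o f) ->
  \int[mu]_(x in `[a, b]) f x =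
    \int[mu]_(x in `[a, c]) f x + \int[mu]_(x in `[c, b]) f x.
Proof.
move=> ac cb fi.
have /= := @Rintegral_itvB R f (BLeft a) (BRight b) c fi.
rewrite !bnd_simp => /(_ ac cb) /eqP; rewrite subr_eq addrC => /eqP ->.
congr (_ + _); apply: Rintegral_itv_obnd_cbnd.
apply: integrableS fi => //.
by apply: subset_itv; rewrite bnd_simp.
Qed.

Lemma integrable_seg_dom a b c d f g (A B : R) : a <= c -> d <= b ->
  measurable_fun (`[a, b] : set R) f ->
  mu.-integrable (`[a, b] : set R) (EFin \o g) ->
  (forall x, `|f x| <= A + B * g x) ->
  mu.-integrable (`[c, d] : set R) (EFin \o f).
Proof.
move=> ac db mf gi fg; apply: (integrable_seg_sub ac db).
have Hi : mu.-integrable (`[a, b] : set R) (EFin \o (fun x => A + B * g x)).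
  apply: (integrableD _ (integrable_cst_seg a b A) (integrableZl _ B gi)) => //.
refine (le_integrable _ _ _ Hi) => //; first exact/measurable_EFinP.
move=> x _ /=; rewrite lee_fin.
by rewrite (le_trans (fg x))// ler_norm.
Qed.

End SegmentIntegral.

(** * Stopping by bisection *)

Section Bisection.
Context {R : realType}.
Variables (F G E : R -> R) (a b r : R).
Hypothesis Fc : {within `[a, b], continuous F}.
Hypothesis Er : 0 < r.
Hypothesis E_nd : forall c d, a <= c -> c <= d -> d <= b -> E c <= E d.
Hypothesis GF : forall c d, a <= c -> c < d -> d <= b -> F c = F d -> G d <= G c.
Hypothesis GE : forall c d, a <= c -> c <= d -> d <= b -> d - c <= r ->
  F d <= F c -> G d - G c <= E d - E c.

(** This is the stopping-time argument, freed from measure theory: F, G and E are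
the indefinite integrals of phi - alpha, of the function to be estimated, and
of an error that is small in total.  Intervals on which F has the same value
at both ends (mean exactly alpha) are harmless by GF, short intervals on which
F does not increase cost only their error by GE, and halving repeatedly
reduces every interval on which F does not increase to these two kinds. *)
Lemma bisection_le : a <= b -> F b <= F a -> G b - G a <= E b - E a.
Proof.
have GF' c d : a <= c -> c <= d -> d <= b -> F c = F d -> G d <= G c.
  by move=> ac; rewrite le_eqVlt => /predU1P[->//|]; exact: GF.
have ivt c d v : a <= c -> c <= d -> d <= b ->
    (F c <= v <= F d) || (F d <= v <= F c) -> exists2 x, c <= x <= d & F x = v.
  move=> ac cd db h; have [||x xcd Fx] := @IVT _ F c d v cd.
  - by apply: continuous_subspaceW Fc; apply: subset_itv; rewrite bnd_simp.
  - rewrite ge_min le_max; case/orP: h => /andP[-> ->] //; by rewrite !orbT.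
  - by exists x => //; move: xcd; rewrite in_itv.
suff main n c d : a <= c -> c <= d -> d <= b -> d - c <= r * 2 ^+ n ->
    F d <= F c -> G d - G c <= E d - E c.
  move=> ab; have [n _ /(_ n (leqnn n)) hn] : \forall n \near \oo, (b - a) / r <= 2 ^+ n.
    near=> n; apply: (@le_trans _ _ (n%:R)).
      near: n; exact: nbhs_infty_ger.
    by rewrite -natrX ler_nat ltnW// ltn_expl.
  by apply: (main n) => //; move: hn; rewrite /= ler_pdivrMr// mulrC.
elim: n c d => [c d ac cd db|n IH c d ac cd db dc FF].
  by rewrite expr0 mulr1; exact: GE.
set m := (c + d) / 2.
have [cm md] : c <= m /\ m <= d by rewrite /m; split; lra.
have [dm mc] : d - m <= r * 2 ^+ n /\ m - c <= r * 2 ^+ n.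
  by move: dc; rewrite exprS /m; set t := 2 ^+ n; split; nra.
have am : a <= m by lra.
have mb : m <= b by lra.
(* F exceeds F c at the midpoint: F takes the value F c again in the right
   half, and the cut is moved there. *)
have [Fmc|Fmc] := leP (F m) (F c); last first.
  have [x /andP[mx xd] Fx] : exists2 x, m <= x <= d & F x = F c.
    by apply: ivt => //; rewrite FF (ltW Fmc) orbT.
  have G1 : G x <= G c by apply: GF' => //; [lra|lra].
  have E1 : E c <= E x by apply: E_nd => //; lra.
  have G2 : G d - G x <= E d - E x by apply: IH => //; try lra; rewrite Fx.
  lra.
(* Neither half increases F, so the induction hypothesis applies to both. *)
have [Fdm|Fdm] := leP (F d) (F m).
  have G1 : G m - G c <= E m - E c by apply: IH.
  have G2 : G d - G m <= E d - E m by apply: IH.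
  lra.
(* F increases on the right half: symmetrically, the cut moves to a point of
   the left half at which F already has the value F d. *)
have [x /andP[cx xm] Fx] : exists2 x, c <= x <= m & F x = F d.
  by apply: ivt => //; rewrite FF (ltW Fdm) orbT.
have G1 : G d <= G x by apply: GF' => //; lra.
have E1 : E x <= E d by apply: E_nd => //; lra.
have G2 : G x - G c <= E x - E c by apply: IH => //; try lra; rewrite Fx.
lra.
Unshelve. all: by end_near. Qed.

End Bisection.

(** * The excess over a level *)

Section UniformContinuity.
Context {R : realType}.

Lemma continuous_seg_modulus (g : R -> R) a b eta : continuous g -> 0 < eta ->
  exists2 r, 0 < r & forall x y, x \in `[a, b] -> `|x - y| <= r ->
    `|g x - g y| <= eta.
Proof.
move=> gc eta0.
have /compact_near_coveringP Kc := @segment_compact R a b.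
have := Kc _ (0:R)^'+ (fun r x => forall y, `|x - y| <= r -> `|g x - g y| <= eta) _.
case => [x _|e /= e0 He].
- have : \forall z \near x, `|g x - g z| < eta / 2.
    by have /cvgrPdist_lt := gc x; apply; rewrite divr_gt0.
  move=> [d /= d0 Hd].
  exists (ball x (d / 2), [set r | r < d / 2]) => /=.
    split; first by apply: nbhsx_ballx; rewrite divr_gt0.
    exact: nbhs_right_lt (divr_gt0 d0 _).
  move=> [x' r] /= [xx' rd] y xy.
  have xx2 : `|x - x'| < d / 2 by [].
  have h1 : `|g x - g x'| < eta / 2 by apply: Hd => /=; lra.
  have h2 : `|g x - g y| < eta / 2.
    apply: Hd; rewrite /= (le_lt_trans (ler_distD x' _ _))//.
    by rewrite (splitr d) ltrD// (le_lt_trans xy).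
  rewrite (le_trans (ler_distD (g x) _ _))// (splitr eta) lerD//.
    by rewrite distrC ltW.
  exact: ltW.
exists (e / 2) => [|x y xab xy]; first by rewrite divr_gt0.
apply: (He (e / 2)) xy => //=; last by rewrite divr_gt0.
by rewrite sub0r normrN gtr0_norm ?divr_gt0//; lra.
Qed.

End UniformContinuity.

Section Excess.
Context {R : realType}.

Lemma continuous_L1_approx (f : R -> R) a b e :
  mu.-integrable (`[a, b] : set R) (EFin \o f) -> 0 < e ->
  exists2 g : R -> R, continuous g &
    mu.-integrable (`[a, b] : set R) (EFin \o g) /\
    \int[mu]_(x in `[a, b]) `|f x - g x| <= e.
Proof.
move=> fi e0.
have [|||g [gc gi]] := @approximation_continuous_integrable R (`[a, b]) f => //.
  by rewrite /= lebesgue_measure_itv /=; case: ifP => _; rewrite ltry.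
move=> /fine_cvgP[_ /cvgrPdist_le/(_ _ e0)[n _ /(_ n (leqnn n))]].
rewrite /= sub0r normrN => ge; exists (g n) => //; split => //.
exact: le_trans (ler_norm _) ge.
Qed.
Implicit Types (a b : R) (phi : R -> R).

Definition sq_integrable a b phi :=
  measurable_fun (`[a, b] : set R) phi /\
  mu.-integrable (`[a, b] : set R) (EFin \o (fun x => phi x ^+ 2)).

(** Since the mean is the best constant, this says that the variance over each
subsegment is at most eps^2.  Leaving the constant free makes the condition
visibly stable under translations, sign changes and truncations. *)
Definition osc_le eps a b phi := forall c d, a <= c -> c < d -> d <= b ->
  exists k, \int[mu]_(x in `[c, d]) (phi x - k) ^+ 2 <= eps ^+ 2 * (d - c).

Lemma sq_integrable_comp a b c d phi (h : R -> R) (A B : R) :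
  sq_integrable a b phi -> a <= c -> d <= b -> measurable_fun setT h ->
  (forall t, `|h t| <= A + B * t ^+ 2) ->
  mu.-integrable (`[c, d] : set R) (EFin \o (fun x => h (phi x))).
Proof.
move=> [mphi iphi] ac db ch hAB.
apply: (integrable_seg_dom ac db _ iphi) => //.
exact: measurableT_comp mphi.
Qed.

Lemma measurable_pos_part (t : R) : measurable_fun setT (fun s : R => Num.max (s - t) 0).
Proof.
have h1 : measurable_fun setT (fun s : R => s - t) by exact: measurable_funB.
have h2 : measurable_fun setT (fun _ : R => 0 : R) by [].
exact: (measurable_maxr h1 h2).
Qed.

Lemma Rintegral_seg_incr a b c d (f : R -> R) : a <= c -> c <= d -> d <= b ->
  mu.-integrable (`[a, b] : set R) (EFin \o f) ->
  \int[mu]_(x in `[a, d]) f x - \int[mu]_(x in `[a, c]) f x =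
  \int[mu]_(x in `[c, d]) f x.
Proof.
move=> ac cd db fi.
have fi' : mu.-integrable (`[a, d] : set R) (EFin \o f).
  exact: integrable_seg_sub (lexx a) db fi.
have -> := Rintegral_seg_split ac cd fi'.
by rewrite addrAC subrr add0r.
Qed.

Lemma sq_integrable_id a b c d phi : sq_integrable a b phi -> a <= c -> d <= b ->
  mu.-integrable (`[c, d] : set R) (EFin \o phi).
Proof.
move=> iphi ac db; apply: (sq_integrable_comp (h := idfun) (A := 1) (B := 1) iphi) => //.
- exact: measurable_id.
- by move=> t /=; rewrite ler_norml; apply/andP; split; nra.
Qed.

Lemma sq_integrable_shift a b c d phi k : sq_integrable a b phi -> a <= c -> d <= b ->
  mu.-integrable (`[c, d] : set R) (EFin \o (fun x => phi x - k)).
Proof.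
move=> iphi ac db.
apply: (sq_integrable_comp (h := fun t => t - k) (A := 1 + `|k|) (B := 1) iphi) => //.
- exact: measurable_funB.
- by move=> t; rewrite (le_trans (ler_normB _ _))// addrAC lerD2r ler_norml; apply/andP; split; nra.
Qed.

Lemma sq_integrable_shift2 a b c d phi k : sq_integrable a b phi -> a <= c -> d <= b ->
  mu.-integrable (`[c, d] : set R) (EFin \o (fun x => (phi x - k) ^+ 2)).
Proof.
move=> iphi ac db.
apply: (sq_integrable_comp (h := fun t => (t - k) ^+ 2) (A := 2 * k ^+ 2) (B := 2) iphi) => //.
- by apply: measurable_funX; exact: measurable_funB.
- by move=> t; rewrite ger0_norm ?sqr_ge0//; have := sqr_ge0 (t + k); nra.
Qed.

Lemma pos_part_sq_le (t y : R) : Num.max (t - y) 0 ^+ 2 <= 2 * t ^+ 2 + 2 * y ^+ 2.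
Proof.
have := sqr_ge0 (t + y); have := sqr_ge0 t; have := sqr_ge0 y.
by case: (leP (t - y) 0) => ?; nra.
Qed.

Lemma sq_integrable_pos_part2 a b c d phi y : sq_integrable a b phi ->
  a <= c -> d <= b ->
  mu.-integrable (`[c, d] : set R) (EFin \o (fun x => Num.max (phi x - y) 0 ^+ 2)).
Proof.
move=> iphi ac db; apply: (sq_integrable_comp (h := fun t => Num.max (t - y) 0 ^+ 2)
  (A := 2 * y ^+ 2) (B := 2) iphi) => //.
  by apply: measurable_funX; exact: measurable_pos_part.
by move=> t; rewrite ger0_norm ?sqr_ge0//; have := pos_part_sq_le t y; lra.
Qed.

Lemma sq_integrable_pos_part a b c d phi y : sq_integrable a b phi ->
  a <= c -> d <= b ->
  mu.-integrable (`[c, d] : set R) (EFin \o (fun x => Num.max (phi x - y) 0)).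
Proof.
move=> iphi ac db; apply: (sq_integrable_comp (h := fun t => Num.max (t - y) 0)
  (A := 2 * y ^+ 2 + 1) (B := 2) iphi) => //; first exact: measurable_pos_part.
move=> t; have := pos_part_sq_le t y; set p := Num.max _ _.
have p0 : 0 <= p by rewrite /p le_max lexx orbT.
by rewrite ger0_norm//; nra.
Qed.

(** The expansion behind the extremality of the mean: the middle term vanishes
when m is the mean. *)
Lemma Rintegral_sq_shift a b c d phi k m : sq_integrable a b phi ->
  a <= c -> c <= d -> d <= b ->
  \int[mu]_(x in `[c, d]) (phi x - k) ^+ 2 =
  \int[mu]_(x in `[c, d]) (phi x - m) ^+ 2 +
  2 * (m - k) * \int[mu]_(x in `[c, d]) (phi x - m) + (m - k) ^+ 2 * (d - c).
Proof.
move=> iphi ac cd db.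
have i1 := sq_integrable_shift m iphi ac db.
have i2 := sq_integrable_shift2 m iphi ac db.
have i3 : mu.-integrable (`[c, d] : set R) (EFin \o (fun x => 2 * (m - k) * (phi x - m))).
  exact: (integrableZl _ (2 * (m - k)) i1).
rewrite -(Rintegral_seg_cst _ cd) -RintegralZl// -RintegralD// -RintegralD//; last 2 first.
- exact: (integrableD _ i2 i3).
- exact: integrable_cst_seg.
by apply: eq_Rintegral => x _; lra.
Qed.

(** If phi has mean at most al and g is almost constant, then g exceeds al at most
by about the mean of |phi - g|.  Applied at small scales to a continuous
approximation g of phi, this makes the part of phi above al negligible. *)
Lemma Rintegral_pos_part_le c d phi (g : R -> R) al eta : c <= d ->
  mu.-integrable (`[c, d] : set R) (EFin \o phi) ->
  mu.-integrable (`[c, d] : set R) (EFin \o (fun x => `|phi x - g x|)) ->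
  (forall x, x \in `[c, d] -> `|g x - g c| <= eta) ->
  \int[mu]_(x in `[c, d]) phi x <= al * (d - c) ->
  \int[mu]_(x in `[c, d]) Num.max (phi x - al) 0 <=
  2 * \int[mu]_(x in `[c, d]) `|phi x - g x| + 2 * (eta * (d - c)).
Proof.
move=> cd iphi idg gcd mcd.
set D := \int[mu]_(x in `[c, d]) `|phi x - g x|.
have D0 : 0 <= D by exact: Rintegral_ge0.
have eta0 : 0 <= eta.
  by apply: le_trans (gcd c _); rewrite ?normr_ge0// in_itv /= lexx.
have dc0 : 0 <= d - c by rewrite subr_ge0.
pose kap := Num.max (g c - al) 0.
have kap0 : 0 <= kap by rewrite le_max lexx orbT.
have kapE : kap * (d - c) <= D + eta * (d - c).
  rewrite /kap; case: (leP (g c - al) 0) => _.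
    by rewrite mul0r addr_ge0// mulr_ge0.
  have : \int[mu]_(x in `[c, d]) (g c - eta) <=
      \int[mu]_(x in `[c, d]) (phi x + `|phi x - g x|).
    apply: le_Rintegral => //.
    - exact: integrable_cst_seg.
    - exact: (integrableD _ iphi idg).
    move=> x /gcd; rewrite ler_norml => /andP[gx _].
    have := ler_norm (g x - phi x); rewrite distrC.
    by clear -gx; lra.
  rewrite Rintegral_seg_cst// RintegralD// -/D.
  by set J := Rintegral _ _ _ in mcd *; clear -mcd; lra.
have ikap := integrable_cst_seg c d (kap + eta).
apply: (@le_trans _ _ (\int[mu]_(x in `[c, d]) ((kap + eta) + `|phi x - g x|))).
  apply: le_Rintegral => //; last 2 first.
  - exact: (integrableD _ ikap idg).
  - move=> x xcd.
    have gk : g c - al <= kap by rewrite le_max lexx.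
    have pg := ler_norm (phi x - g x).
    have := gcd x xcd; rewrite ler_norml => /andP[_ gx].
    rewrite ge_max; apply/andP; split; last by rewrite !addr_ge0.
    by clear -gk pg gx; lra.
  refine (le_integrable _ _ _ (integrableD _ (integrable_cst_seg c d `|al|)
    (integrable_norm iphi))) => //.
    have mphi : measurable_fun (`[c, d] : set R) phi.
      by case/integrableP : iphi => /measurable_EFinP.
    apply/measurable_EFinP.
    exact: (measurableT_comp (measurable_pos_part al) mphi).
  move=> x _ /=; rewrite lee_fin [leRHS]ger0_norm ?addr_ge0//.
  rewrite ger0_norm ?le_max ?lexx ?orbT// ge_max addr_ge0// andbT addrC.
  by rewrite (le_trans (ler_norm _))// ler_normB.
rewrite RintegralD// Rintegral_seg_cst// -/D; clear -kapE; lra.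
Qed.

(** The excess inequality.  With al = beta + eps and p the excess, the function
h = p^2 - 2 eps p lies below (phi - al)^2 - eps^2, whose integral is
nonpositive over every interval of mean al, and below a multiple of
(phi - al)_+, whose integral is negligible over short intervals of mean at
most al; these are the two kinds of intervals in bisection_le.  The bound M
on phi makes the multiple finite. *)
Lemma excess_le a b phi eps M beta : a < b -> 0 <= eps ->
  sq_integrable a b phi -> osc_le eps a b phi -> (forall x, phi x <= M) ->
  \int[mu]_(x in `[a, b]) phi x <= (beta + eps) * (b - a) ->
  \int[mu]_(x in `[a, b]) (Num.max (phi x - beta) 0) ^+ 2 <=
  2 * eps * \int[mu]_(x in `[a, b]) Num.max (phi x - beta) 0.
Proof.
move=> ab eps0 iphi osc phiM mean.
set al := beta + eps.
pose p t : R := Num.max (t - beta) 0.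
pose h t : R := p t ^+ 2 - 2 * eps * p t.
have mp : measurable_fun setT p by exact: measurable_pos_part.
have mp2 : measurable_fun setT (fun t => p t ^+ 2) by exact: measurable_funX.
have mh : measurable_fun setT h by apply: measurable_funB => //; exact: measurable_funM.
have p0 t : 0 <= p t by rewrite /p le_max lexx orbT.
have p2 t : p t ^+ 2 <= 2 * t ^+ 2 + 2 * beta ^+ 2 by exact: pos_part_sq_le.
have ip := sq_integrable_pos_part beta iphi.
have ip2 := sq_integrable_pos_part2 beta iphi.
have ih c d : a <= c -> d <= b ->
    mu.-integrable (`[c, d] : set R) (EFin \o (fun x => h (phi x))).
  move=> ac db; apply: (sq_integrable_comp (A := 4 * beta ^+ 2 + eps ^+ 2) (B := 4) iphi) => //.
  move=> t; have := p2 t; have := p0 t; rewrite /h ler_norml => ? ?; apply/andP.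
  by have := sqr_ge0 (p t - eps); split; nra.
have iphi1 := sq_integrable_id iphi.
have ial := sq_integrable_shift al iphi.
have ial2 := sq_integrable_shift2 al iphi.
have ipal := sq_integrable_pos_part al iphi.
suff : \int[mu]_(x in `[a, b]) h (phi x) <= 0.
  rewrite RintegralB//; [|exact: ip2|exact: (integrableZl _ (2 * eps) (ip _ _ _ _))].
  by rewrite RintegralZl ?subr_le0//; exact: ip.
have h_osc t : h t <= (t - al) ^+ 2 - eps ^+ 2.
  rewrite /h /p /al; case: (leP (t - beta) 0) => ?; last by nra.
  by rewrite expr0n /= mulr0 subr0; nra.
(* For al < t <= M the factor t - al of (t - al)^2 is at most K. *)
pose K := Num.max (M - al) 0.
have K0 : 0 <= K by rewrite /K le_max lexx orbT.
have h_K t : t <= M -> h t <= K * Num.max (t - al) 0.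
  move=> tM; case: (leP (t - al) 0) => tal.
    rewrite mulr0 /h /p; case: (leP (t - beta) 0) => ?; first by rewrite expr0n /= mulr0 subr0.
    by rewrite /al in tal; nra.
  rewrite (le_trans (h_osc t))// /K; case: (leP (M - al) 0) => ?; nra.
apply/ler_addgt0Pl => del del0; rewrite addr0.
have K1 : 0 < K + 1 by lra.
have ba0 : 0 < b - a by lra.
(* The total error is (K + 1) (2 de1 + 2 eta (b - a)), which equals del. *)
pose de1 := del / (4 * (K + 1)).
pose eta := del / (4 * (K + 1)) / (b - a).
have de10 : 0 < de1 by rewrite divr_gt0// mulr_gt0.
have eta0 : 0 < eta by rewrite divr_gt0.
have [g gc [gi gd]] := continuous_L1_approx (iphi1 a b (lexx a) (lexx b)) de10.
have [r r0 gr] := continuous_seg_modulus a b gc eta0.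
have idg c d : a <= c -> d <= b ->
    mu.-integrable (`[c, d] : set R) (EFin \o (fun x => `|phi x - g x|)).
  move=> ac db.
  have iB : mu.-integrable (`[c, d] : set R) (EFin \o (fun x => phi x - g x)).
    exact: (integrableB _ (iphi1 c d ac db) (integrable_seg_sub ac db gi)).
  exact: (integrable_norm iB).
pose D c d := \int[mu]_(x in `[c, d]) `|phi x - g x|.
pose E x := (K + 1) * (2 * D a x + 2 * eta * (x - a)).
have incr (f : R -> R) (fi : mu.-integrable (`[a, b] : set R) (EFin \o f)) c d
    (ac : a <= c) (cd : c <= d) (db : d <= b) := Rintegral_seg_incr ac cd db fi.
have aa : a <= a by [].
have bb : b <= b by [].
have Dincr := incr _ (idg _ _ aa bb).
have Fincr := incr _ (ial _ _ aa bb).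
have Gincr := incr _ (ih _ _ aa bb).
have D0 c d : 0 <= D c d by exact: Rintegral_ge0.
have Eincr c d : a <= c -> c <= d -> d <= b ->
    E d - E c = (K + 1) * (2 * D c d + 2 * eta * (d - c)).
  move=> ac cd db; have -> : D c d = D a d - D a c by rewrite /D Dincr.
  by rewrite /E; lra.
have int_al c d : a <= c -> c <= d -> d <= b -> \int[mu]_(x in `[c, d]) (phi x - al) =
    \int[mu]_(x in `[c, d]) phi x - al * (d - c).
  move=> ac cd db; rewrite RintegralB ?Rintegral_seg_cst//; first exact: iphi1.
  exact: integrable_cst_seg.
have I0 (f : R -> R) : \int[mu]_(x in `[a, a]) f x = 0 by rewrite set_itv1 Rintegral_set1.
have := @bisection_le R (fun x => \int[mu]_(t in `[a, x]) (phi t - al))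
  (fun x => \int[mu]_(t in `[a, x]) h (phi t)) E a b r _ r0 _ _ _ (ltW ab) _.
rewrite !I0 subr0 => bis; apply: le_trans (bis _ _ _ _ _) _.
- exact: parameterized_integral_continuous (ltW ab) (ial _ _ aa bb).
- move=> c d ac cd db; rewrite -subr_ge0 Eincr//.
  apply: mulr_ge0; first exact: ltW.
  have dc0 : 0 <= d - c by rewrite subr_ge0.
  apply: addr_ge0; first exact: (mulr_ge0 _ (D0 c d)).
  by rewrite mulr_ge0// mulr_ge0// ltW.
- move=> c d ac cd db; have cd' := ltW cd.
  move=> /esym/eqP; rewrite -subr_eq0 Fincr// => /eqP mcd.
  have [k Hk] := osc c d ac cd db.
  rewrite -subr_le0 Gincr//.
  have := Rintegral_sq_shift k al iphi ac (ltW cd) db; rewrite mcd mulr0 addr0 => Hal.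
  have i2 := ial2 c d ac db.
  have ic : mu.-integrable (`[c, d] : set R) (EFin \o cst (eps ^+ 2)).
    exact: integrable_cst_seg.
  apply: (@le_trans _ _ (\int[mu]_(x in `[c, d]) ((phi x - al) ^+ 2 - eps ^+ 2))).
    by apply: le_Rintegral => //; [exact: ih|exact: (integrableB _ i2 ic)].
  rewrite RintegralB// Rintegral_seg_cst ?(ltW cd)// subr_le0 (le_trans _ Hk)// Hal.
  by rewrite lerDl mulr_ge0 ?sqr_ge0// subr_ge0 ltW.
- move=> c d ac cd db dcr; rewrite -subr_le0 Fincr// int_al// subr_le0 => mcd.
  rewrite Gincr// Eincr//.
  have gcd x : x \in `[c, d] -> `|g x - g c| <= eta.
    rewrite in_itv /= => /andP[cx xd]; apply: gr.
      by rewrite in_itv /= (le_trans ac)//= (le_trans xd).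
    by rewrite ger0_norm ?subr_ge0// (le_trans _ dcr)// lerD2r.
  apply: (@le_trans _ _ (\int[mu]_(x in `[c, d]) ((K + 1) * Num.max (phi x - al) 0))).
    apply: le_Rintegral => //; first exact: ih.
      exact: (integrableZl _ (K + 1) (ipal _ _ ac db)).
    move=> x _; rewrite (le_trans (h_K _ (phiM x)))// ler_wpM2r ?lerDl//.
    by rewrite le_max lexx orbT.
  rewrite RintegralZl//; last exact: ipal.
  rewrite ler_pM2l// -mulrA.
  exact: Rintegral_pos_part_le (iphi1 _ _ ac db) (idg _ _ ac db) gcd mcd.
- by have ab' := ltW ab; rewrite int_al// subr_le0.
rewrite /E /D I0 mulr0 subrr mulr0 addr0 mulr0 subr0.
have gd' : D a b <= de1 by [].
rewrite (@le_trans _ _ ((K + 1) * (2 * de1 + 2 * (eta * (b - a)))))//.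
  rewrite ler_pM2l// [2 * (eta * _)]mulrA lerD2r.
  exact: (ler_wpM2l _ gd').
rewrite /eta divfK ?gt_eqF// -/de1.
have : de1 * (4 * (K + 1)) = del by rewrite /de1 divfK// gt_eqF// mulr_gt0.
by clear; lra.
Qed.

End Excess.

(** * From excesses to exponentials *)

Section ExpBound.
Context {R : realType}.
Implicit Types (a b M eps : R) (phi : R -> R).

Lemma EFin_Rintegral (D : set R) (f : R -> R) : measurable D ->
  mu.-integrable D (EFin \o f) ->
  (\int[mu]_(x in D) (f x)%:E)%E = (\int[mu]_(x in D) f x)%:E.
Proof. by move=> mD fi; rewrite /Rintegral fineK//; exact: integrable_fin_num. Qed.

Lemma continuous_seg_integrable (a b : R) (f : R -> R) : continuous f ->
  mu.-integrable (`[a, b] : set R) (EFin \o f).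
Proof.
move=> fc; apply: continuous_compact_integrable; first exact: segment_compact.
exact: continuous_subspaceT.
Qed.

Lemma FTC_seg (a b : R) (f F : R -> R) : a <= b -> continuous f ->
  (forall x : R, is_derive x (1 : R) F (f x)) ->
  \int[mu]_(x in `[a, b]) f x = F b - F a.
Proof.
move=> + fc dF; rewrite le_eqVlt => /predU1P[->|ab].
  by rewrite set_itv1 Rintegral_set1 subrr.
have cF : continuous F.
  move=> x; apply: differentiable_continuous; apply/derivable1_diffP.
  by have [] := dF x.
rewrite /Rintegral (@continuous_FTC2 _ f F a b ab)//.
- exact: continuous_subspaceT.
- split => //.
  + by apply: cvg_at_right_filter; exact: cF.
  + by apply: cvg_at_left_filter; exact: cF.
- by move=> x _; rewrite derive1E; have [] := dF x.
Qed.

Lemma continuous_pos_part (t : R) : continuous (fun s : R => Num.max (t - s) 0).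
Proof.
move=> x; apply: (@continuous_max _ _ (fun s => t - s) (fun=> 0)); last exact: cst_continuous.
by apply: continuousB => //; exact: cst_continuous.
Qed.

(** The integrand vanishes beyond t, so that only the primitive F of its smooth
form on [0, t] matters. *)
Lemma Rintegral_expR_pos_part (t M : R) n (F : R -> R) : t <= M -> 0 <= M ->
  (forall x : R, is_derive x (1 : R) F (expR x * (t - x) ^+ n.+1)) ->
  \int[mu]_(x in `[0, M]) (expR x * Num.max (t - x) 0 ^+ n.+1) =
  F (Num.max t 0) - F 0.
Proof.
move=> tM M0 dF.
have ci : mu.-integrable (`[0, M] : set R) (EFin \o (fun x => expR x * Num.max (t - x) 0 ^+ n.+1)).
  apply: continuous_seg_integrable => x; apply: continuousM; first exact: continuous_expR.
  exact: (@continuous_comp _ _ _ (fun s => Num.max (t - s) 0) (fun y => y ^+ n.+1) x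
    (@continuous_pos_part t x) (@exprn_continuous _ n.+1 _)).
have zero c : t <= c -> c <= M -> \int[mu]_(x in `[c, M]) (expR x * Num.max (t - x) 0 ^+ n.+1) = 0.
  move=> tc cM; rewrite (@eq_Rintegral _ _ _ _ _ (cst 0)) ?Rintegral_seg_cst ?mul0r//.
  move=> x; rewrite inE/= in_itv /= => /andP[cx _]; rewrite max_r ?expr0n ?mulr0//.
  by rewrite subr_le0 (le_trans tc).
have [t0|t0] := leP t 0; first by rewrite zero// subrr.
rewrite (Rintegral_seg_split (ltW t0) tM)// zero// addr0.
rewrite -(FTC_seg (ltW t0) _ dF); last first.
  move=> x; apply: continuousM; first exact: continuous_expR.
  apply: (@continuous_comp _ _ _ (fun s => t - s) (fun y => y ^+ n.+1) x);
    last exact: exprn_continuous.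
  by apply: continuousB => //; exact: cst_continuous.
apply: eq_Rintegral => x; rewrite inE/= in_itv /= => /andP[_ xt].
by rewrite max_l// subr_ge0.
Qed.

Lemma Rintegral_expR_pos_part1 (t M : R) : t <= M -> 0 <= M ->
  \int[mu]_(x in `[0, M]) (expR x * Num.max (t - x) 0 ^+ 1) =
  expR (Num.max t 0) - 1 - Num.max t 0.
Proof.
move=> tM M0.
have dF (x : R) : is_derive x (1 : R) (fun x => expR x * (t - x + 1)) (expR x * (t - x) ^+ 1).
  by apply: is_derive_eq; rewrite /GRing.scale /=; lra.
rewrite (Rintegral_expR_pos_part tM M0 dF).
by rewrite expR0 subr0; case: (leP t 0) => _; rewrite ?expR0; lra.
Qed.

Lemma Rintegral_expR_pos_part2 (t M : R) : t <= M -> 0 <= M ->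
  \int[mu]_(x in `[0, M]) (expR x * Num.max (t - x) 0 ^+ 2) =
  2 * (expR (Num.max t 0) - 1 - Num.max t 0) - (Num.max t 0) ^+ 2.
Proof.
move=> tM M0.
have dF (x : R) : is_derive x (1 : R) (fun x => expR x * ((t - x) ^+ 2 + (t - x) * 2 + 2))
    (expR x * (t - x) ^+ 2).
  by apply: is_derive_eq; rewrite /GRing.scale /=; lra.
rewrite (Rintegral_expR_pos_part tM M0 dF).
by rewrite expR0 subr0; case: (leP t 0) => _; rewrite ?expR0; lra.
Qed.

(** The excess inequality at level beta, integrated against e^beta d beta: by
Tonelli both sides become integrals over x of explicit functions of phi x,
because the integrals of e^beta (t - beta)_+ and e^beta (t - beta)_+^2 over
beta >= 0 are e^t - 1 - t and 2 (e^t - 1 - t) - t^2 for t >= 0.  Boundedness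
of phi makes all terms finite, so that they can be moved across the inequality. *)
Lemma exp_pos_part_le_bounded a b phi eps M : a < b -> 0 <= eps -> 0 <= M ->
  sq_integrable a b phi -> osc_le eps a b phi -> (forall x, phi x <= M) ->
  \int[mu]_(x in `[a, b]) phi x <= 0 ->
  (1 - eps) * \int[mu]_(x in `[a, b])
    (expR (Num.max (phi x) 0) - 1 - Num.max (phi x) 0) <=
  2^-1 * \int[mu]_(x in `[a, b]) Num.max (phi x) 0 ^+ 2.
Proof.
move=> ab eps0 M0 iphi osc phiM mean.
pose P (t : R) : R := Num.max t 0.
(* Extension by zero, so that the product integrand is measurable on the plane. *)
pose psi := phi \_ (`[a, b] : set R).
have mpsi : measurable_fun setT psi by apply/(measurable_restrictT phi) => //; case: iphi.
pose f n (z : R * R) : R := \1_(`[a, b] : set R) z.1 * \1_(`[0, M] : set R) z.2 *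
  (expR z.2 * P (psi z.1 - z.2) ^+ n).
have P0 t : 0 <= P t by rewrite /P le_max lexx orbT.
have f0 n z : 0 <= f n z by rewrite !mulr_ge0 ?exprn_ge0 ?expR_ge0// indicE.
have mP : measurable_fun setT P.
  have h2 : measurable_fun setT (fun _ : R => 0 : R) by [].
  exact: (measurable_maxr (@measurable_id _ R _) h2).
have mPz : measurable_fun setT (fun z : R * R => P (psi z.1 - z.2)).
  exact: (measurableT_comp mP (measurable_funB (measurableT_comp mpsi measurable_fst)
    measurable_snd)).
have mf n : measurable_fun setT (EFin \o f n).
  apply/measurable_EFinP; apply: measurable_funM.
    apply: measurable_funM.
      exact: (measurableT_comp (measurable_indic _) measurable_fst).
    exact: (measurableT_comp (measurable_indic _) measurable_snd).
  apply: measurable_funM; last exact: measurable_funX.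
  by apply: (measurableT_comp (f := @expR R)) => //; exact: measurable_expR.
have aa : a <= a by [].
have bb : b <= b by [].
have iP2 y : mu.-integrable (`[a, b] : set R) (EFin \o (fun x => P (phi x - y) ^+ 2)).
  exact: sq_integrable_pos_part2 iphi aa bb.
have iP1 y : mu.-integrable (`[a, b] : set R) (EFin \o (fun x => P (phi x - y) ^+ 1)).
  exact: sq_integrable_pos_part iphi aa bb.
have Gf n (y : R) : mu.-integrable (`[a, b] : set R) (EFin \o (fun x => P (phi x - y) ^+ n.+1)) ->
    (\int[mu]_x (EFin \o f n.+1) (x, y))%E =
    (\1_(`[0, M] : set R) y * (expR y * \int[mu]_(x in `[a, b]) (P (phi x - y) ^+ n.+1)))%:E.
  move=> iP; rewrite mulrA -RintegralZl// -EFin_Rintegral//; last exact: (integrableZl _ _ iP).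
  rewrite [RHS]integral_mkcond; apply: eq_integral => x _.
  rewrite /= /f /psi /patch; case: ifPn => xab; rewrite indicE /=.
    by rewrite xab mul1r mulrA.
  by rewrite (negbTE xab) !mul0r.
pose Phi n x := \int[mu]_(y in `[0, M]) (expR y * P (phi x - y) ^+ n.+1).
have Ff n (x : R) : (\int[mu]_y (EFin \o f n.+1) (x, y))%E =
    (\1_(`[a, b] : set R) x * Phi n x)%:E.
  rewrite indicE; case: (boolP (x \in _)) => xab; rewrite ?mul1r ?mul0r; last first.
    by rewrite integral0_eq// => y _; rewrite /= /f /= indicE (negbTE xab) !mul0r.
  rewrite -EFin_Rintegral//; last first.
    apply: continuous_seg_integrable => y; apply: continuousM; first exact: continuous_expR.
    exact: (@continuous_comp _ _ _ (fun s => P (phi x - s)) (fun y => y ^+ n.+1) y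
      (@continuous_pos_part _ y) (@exprn_continuous _ n.+1 _)).
  rewrite [RHS]integral_mkcond; apply: eq_integral => y _.
  rewrite /= /f /psi /patch xab /= !indicE xab mul1r; case: ifPn => yM; first by rewrite mul1r.
  by rewrite mul0r.
have intPhi n : mu.-integrable (`[a, b] : set R) (EFin \o Phi n) ->
    (\int[mu]_(x in `[a, b]) Phi n x)%:E =
    (\int[mu]_y \int[mu]_x (EFin \o f n.+1) (x, y))%E.
  move=> iPhi; rewrite -fubini_tonelli; [|exact: mf|by move=> z; rewrite lee_fin].
  under [RHS]eq_integral do rewrite Ff.
  rewrite -(EFin_Rintegral _ iPhi)// [LHS]integral_mkcond; apply: eq_integral => x _.
  by rewrite /patch /= indicE; case: ifPn => _; rewrite ?mul1r ?mul0r.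
have Phi1 x : Phi 0 x = expR (P (phi x)) - 1 - P (phi x).
  exact: Rintegral_expR_pos_part1.
have Phi2 x : Phi 1 x = 2 * (expR (P (phi x)) - 1 - P (phi x)) - P (phi x) ^+ 2.
  exact: Rintegral_expR_pos_part2.
have iPphi : mu.-integrable (`[a, b] : set R) (EFin \o (fun x => P (phi x))).
  rewrite (_ : (fun x => P (phi x)) = (fun x => P (phi x - 0) ^+ 1)); first exact: iP1.
  by apply/funext => x; rewrite subr0.
have iPphi2 : mu.-integrable (`[a, b] : set R) (EFin \o (fun x => P (phi x) ^+ 2)).
  rewrite (_ : (fun x => P (phi x) ^+ 2) = (fun x => P (phi x - 0) ^+ 2)); first exact: iP2.
  by apply/funext => x; rewrite subr0.
have iE : mu.-integrable (`[a, b] : set R) (EFin \o (fun x => expR (P (phi x)))).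
  refine (le_integrable _ _ _ (integrable_cst_seg a b (expR M))) => //.
    apply/measurable_EFinP.
    apply: (measurableT_comp (f := @expR R)); first exact: measurable_expR.
    exact: (measurableT_comp mP iphi.1).
  move=> x _ /=; rewrite lee_fin !ger0_norm ?expR_ge0// ler_expR.
  by rewrite ge_max phiM.
have iPhi1 : mu.-integrable (`[a, b] : set R) (EFin \o Phi 0).
  rewrite (_ : Phi 0 = fun x => expR (P (phi x)) - 1 - P (phi x)); last exact/funext.
  exact: (integrableB _ (integrableB _ iE (integrable_cst_seg a b 1)) iPphi).
have iPhi2 : mu.-integrable (`[a, b] : set R) (EFin \o Phi 1).
  rewrite (_ : Phi 1 = fun x => 2 * Phi 0 x - P (phi x) ^+ 2); last first.
    by apply/funext => x; rewrite Phi1 Phi2.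
  exact: (integrableB _ (integrableZl _ 2 iPhi1) iPphi2).
have mG n : measurable_fun setT (fun y => \int[mu]_x (EFin \o f n) (x, y))%E.
  apply: (@measurable_fun_fubini_tonelli_G _ _ _ _ R mu (EFin \o f n)); first exact: mf.
  by move=> z; rewrite lee_fin.
have key : \int[mu]_(x in `[a, b]) Phi 1 x <= 2 * eps * \int[mu]_(x in `[a, b]) Phi 0 x.
  rewrite -lee_fin EFinM.
  rewrite (intPhi _ iPhi2) (intPhi _ iPhi1) -ge0_integralZl//.
  - apply: ge0_le_integral => //.
    + by move=> y _; apply: integral_ge0 => x _; rewrite lee_fin.
    + exact: mG.
    + by apply: measurable_funeM; exact: mG.
    move=> y _; rewrite !Gf// -EFinM lee_fin.
    rewrite indicE; case: (boolP (y \in _)); rewrite ?mul0r ?mulr0// !mul1r.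
    rewrite inE /= in_itv /= => /andP[y0 _].
    rewrite mulrCA ler_pM2l ?expR_gt0//.
    apply: excess_le iphi osc phiM _ => //.
    by rewrite (le_trans mean)// mulr_ge0//; [rewrite addr_ge0|rewrite subr_ge0 ltW].
  - exact: mG.
  - by move=> y _; apply: integral_ge0 => x _; rewrite lee_fin.
  - by rewrite lee_fin mulr_ge0.
have E2 : \int[mu]_(x in `[a, b]) Phi 1 x = 2 * \int[mu]_(x in `[a, b]) Phi 0 x -
    \int[mu]_(x in `[a, b]) P (phi x) ^+ 2.
  rewrite -RintegralZl// -RintegralB//; last exact: (integrableZl _ 2 iPhi1).
  by apply: eq_Rintegral => x _; rewrite Phi1 Phi2.
have -> : \int[mu]_(x in `[a, b]) (expR (Num.max (phi x) 0) - 1 - Num.max (phi x) 0) =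
    \int[mu]_(x in `[a, b]) Phi 0 x by apply: eq_Rintegral => x _; rewrite Phi1.
move: key; rewrite E2; clear; set I1 := Rintegral _ _ _; set I2 := Rintegral _ _ _.
lra.
Qed.

End ExpBound.

(** * The exponential of the absolute value *)

Section ExpAbs.
Context {R : realType}.
Implicit Types (a b M eps : R) (phi : R -> R).

Lemma sq_integrable_min a b phi M : sq_integrable a b phi ->
  sq_integrable a b (fun x => Num.min (phi x) M).
Proof.
move=> iphi; have mM : measurable_fun (`[a, b] : set R) (fun=> M) by [].
have mmin := measurable_minr iphi.1 mM.
split => //; refine (integrable_seg_dom (A := M ^+ 2) (B := 1) (lexx a) (lexx b) _ iphi.2 _).
  exact: measurable_funX.
move=> x; rewrite ger0_norm ?sqr_ge0// mul1r; have := sqr_ge0 (phi x); have := sqr_ge0 M.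
by case: (leP (phi x) M) => _; lra.
Qed.

(** Truncation is a contraction, so the truncated constant does the job for the
truncated function. *)
Lemma osc_le_min a b phi eps M : sq_integrable a b phi -> osc_le eps a b phi ->
  osc_le eps a b (fun x => Num.min (phi x) M).
Proof.
move=> iphi osc c d ac cd db; have [k Hk] := osc c d ac cd db.
exists (Num.min k M); apply: le_trans Hk; apply: le_Rintegral => //.
- exact: (sq_integrable_shift2 _ (sq_integrable_min M iphi)).
- exact: (sq_integrable_shift2 _ iphi).
- move=> x _; have := sqr_ge0 (phi x - k); case: (leP (phi x) M) => ?; case: (leP k M) => ?; nra.
Qed.

Lemma sq_integrable_opp a b phi : sq_integrable a b phi ->
  sq_integrable a b (fun x => - phi x).
Proof.
move=> [mphi iphi]; split; first exact: measurable_funN.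
by have -> : (fun x => (- phi x) ^+ 2) = (fun x => phi x ^+ 2) by apply/funext => x; rewrite sqrrN.
Qed.

Lemma osc_le_opp a b phi eps : osc_le eps a b phi -> osc_le eps a b (fun x => - phi x).
Proof.
move=> osc c d ac cd db; have [k Hk] := osc c d ac cd db; exists (- k).
apply: le_trans Hk; rewrite le_eqVlt; apply/orP; left; apply/eqP.
by apply: eq_Rintegral => x _; lra.
Qed.

Lemma sq_integrable_translate a b phi m : sq_integrable a b phi ->
  sq_integrable a b (fun x => phi x - m).
Proof.
move=> iphi; split; first by apply: measurable_funB => //; exact: iphi.1.
exact: sq_integrable_shift2 iphi (lexx a) (lexx b).
Qed.

Lemma osc_le_translate a b phi eps m : osc_le eps a b phi ->
  osc_le eps a b (fun x => phi x - m).
Proof.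
move=> osc c d ac cd db; have [k Hk] := osc c d ac cd db; exists (k - m).
apply: le_trans Hk; rewrite le_eqVlt; apply/orP; left; apply/eqP.
by apply: eq_Rintegral => x _; lra.
Qed.

(** The right-hand side does not depend on the truncation level M, which prepares
the passage to the limit. *)
Lemma exp_pos_part_le a b phi eps M : a < b -> 0 <= eps < 1 -> 0 <= M ->
  sq_integrable a b phi -> osc_le eps a b phi ->
  \int[mu]_(x in `[a, b]) phi x <= 0 ->
  \int[mu]_(x in `[a, b]) (expR (Num.max (Num.min (phi x) M) 0) - 1 -
    Num.max (Num.min (phi x) M) 0) <=
  (2 * (1 - eps))^-1 * \int[mu]_(x in `[a, b]) Num.max (phi x) 0 ^+ 2.
Proof.
move=> ab /andP[eps0 eps1] M0 iphi osc mean.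
have aa : a <= a by []. have bb : b <= b by [].
have im := sq_integrable_min M iphi.
have H := @exp_pos_part_le_bounded R a b _ eps M ab eps0 M0 im (osc_le_min M iphi osc) _ _.
have e0 : 0 < 1 - eps by rewrite subr_gt0.
rewrite invfM [2^-1 * _]mulrC -mulrA ler_pdivlMl//; apply: le_trans (H _ _) _.
- by move=> x; rewrite ge_min lexx orbT.
- apply: le_trans mean; apply: le_Rintegral => //.
  + exact: sq_integrable_id im aa bb.
  + exact: sq_integrable_id iphi aa bb.
  + by move=> x _; rewrite ge_min lexx.
rewrite ler_pM2l ?invr_gt0//; apply: le_Rintegral => //.
- have := sq_integrable_pos_part2 0 im aa bb; congr (_.-integrable _ _).
  by apply/funext => x /=; rewrite subr0.
- have := sq_integrable_pos_part2 0 iphi aa bb; congr (_.-integrable _ _).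
  by apply/funext => x /=; rewrite subr0.
- move=> x _; case: (leP (phi x) M) => h1; first by [].
  by case: (leP (phi x) 0); case: (leP M 0) => *; nra.
Qed.

Lemma Rintegral_sq_le a b phi eps : a < b -> sq_integrable a b phi -> osc_le eps a b phi ->
  \int[mu]_(x in `[a, b]) phi x = 0 ->
  \int[mu]_(x in `[a, b]) phi x ^+ 2 <= eps ^+ 2 * (b - a).
Proof.
move=> ab iphi osc mean; have aa : a <= a by []. have bb : b <= b by [].
have [k] := osc a b aa ab bb; apply: le_trans.
rewrite (Rintegral_sq_shift k 0 iphi aa (ltW ab) bb).
have -> : \int[mu]_(x in `[a, b]) (phi x - 0) ^+ 2 = \int[mu]_(x in `[a, b]) phi x ^+ 2.
  by apply: eq_Rintegral => x _; rewrite subr0.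
have -> : \int[mu]_(x in `[a, b]) (phi x - 0) = \int[mu]_(x in `[a, b]) phi x.
  by apply: eq_Rintegral => x _; rewrite subr0.
by rewrite mean mulr0 addr0 lerDl mulr_ge0 ?sqr_ge0// subr_ge0 ltW.
Qed.

(** This is the Cauchy-Schwarz inequality, obtained from
|y| <= y^2 / (2 s) + s / 2 by letting s decrease to eps. *)
Lemma Rintegral_norm_le a b phi eps : a < b -> 0 <= eps ->
  sq_integrable a b phi ->
  \int[mu]_(x in `[a, b]) phi x ^+ 2 <= eps ^+ 2 * (b - a) ->
  \int[mu]_(x in `[a, b]) `|phi x| <= eps * (b - a).
Proof.
move=> ab eps0 iphi sq; have aa : a <= a by []. have bb : b <= b by [].
have ba0 : 0 < b - a by rewrite subr_gt0.
apply/ler_addgt0Pr => e e0.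
(* s > 0 even if eps = 0, and s * (b - a) is the required bound. *)
pose s := eps + e / (b - a).
have ee0 : 0 < e / (b - a) by rewrite divr_gt0.
have s0 : 0 < s by rewrite /s ltr_wpDl.
have hs : (2 * s)^-1 * s = 2^-1 by rewrite invfM -mulrA mulVf ?mulr1// gt_eqF.
have -> : eps * (b - a) + e = s * (b - a) by rewrite /s mulrDl divfK ?gt_eqF.
apply: (@le_trans _ _ (\int[mu]_(x in `[a, b]) ((2 * s)^-1 * phi x ^+ 2 + s / 2))).
  apply: le_Rintegral => //.
  - exact: (integrable_norm (sq_integrable_id iphi aa bb)).
  - exact: (integrableD _ (integrableZl _ _ iphi.2) (integrable_cst_seg _ _ _)).
  - move=> x _; rewrite -(real_normK (num_real (phi x))) -subr_ge0.
    have -> : (2 * s)^-1 * `|phi x| ^+ 2 + s / 2 - `|phi x| = (2 * s)^-1 * (`|phi x| - s) ^+ 2.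
      have -> : (2 * s)^-1 * (`|phi x| - s) ^+ 2 = (2 * s)^-1 * `|phi x| ^+ 2 -
        2 * ((2 * s)^-1 * s) * `|phi x| + (2 * s)^-1 * s * s by lra.
      by rewrite hs; lra.
    by rewrite mulr_ge0 ?sqr_ge0// invr_ge0 mulr_ge0// ltW.
rewrite RintegralD//; last 2 first.
- exact: (integrableZl _ _ iphi.2).
- exact: integrable_cst_seg.
rewrite Rintegral_seg_cst ?(ltW ab)// RintegralZl//; last exact: iphi.2.
have : (2 * s)^-1 * \int[mu]_(x in `[a, b]) phi x ^+ 2 <= (2 * s)^-1 * (s ^+ 2 * (b - a)).
  rewrite ler_pM2l ?invr_gt0 ?mulr_gt0//; apply: le_trans sq _.
  by rewrite ler_pM2r// ler_pXn2r ?nnegrE// ?(ltW s0)// /s lerDl ltW.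
have -> : (2 * s)^-1 * (s ^+ 2 * (b - a)) = s / 2 * (b - a).
  by rewrite expr2 !mulrA hs; lra.
by clear; set J := (2 * s)^-1 * _; lra.
Qed.

Lemma sq_integrable_exp a b phi M : 0 <= M -> sq_integrable a b phi ->
  mu.-integrable (`[a, b] : set R) (EFin \o (fun x =>
    expR (Num.max (Num.min (phi x) M) 0) - 1 - Num.max (Num.min (phi x) M) 0)).
Proof.
move=> M0 iphi.
have mM : measurable_fun setT (fun _ : R => M) by [].
have m0 : measurable_fun setT (fun _ : R => 0 : R) by [].
have mm : measurable_fun setT (fun t : R => Num.max (Num.min t M) 0).
  exact: (measurable_maxr (measurable_minr (@measurable_id _ R _) mM) m0).
apply: (sq_integrable_comp (h := fun t => expR (Num.max (Num.min t M) 0) - 1 -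
   Num.max (Num.min t M) 0) (A := expR M) (B := 0) iphi) => //.
  apply: measurable_funB => //; apply: measurable_funB => //.
  by apply: (measurableT_comp (f := @expR R)) => //; exact: measurable_expR.
move=> t; rewrite mul0r addr0; set y := Num.max _ _.
have y0 : 0 <= y by rewrite le_max lexx orbT.
have yM : y <= M by rewrite ge_max M0 ge_min lexx orbT.
have := expR_ge1Dx y; have : expR y <= expR M by rewrite ler_expR.
by move=> h1 h2; rewrite ger0_norm; lra.
Qed.

(** At most one of t and - t has a nonzero positive part, so the two exponential
remainders on the right never interfere. *)
Lemma exp_min_norm_le (t M : R) : 0 <= M -> expR (Num.min `|t| M) <=
  (expR (Num.max (Num.min t M) 0) - 1 - Num.max (Num.min t M) 0 +
  (expR (Num.max (Num.min (- t) M) 0) - 1 - Num.max (Num.min (- t) M) 0)) + (1 + `|t|).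
Proof.
move=> M0; wlog t0 : t / 0 <= t => [H|].
  have [/H//|t0] := leP 0 t; have := H (- t).
  by rewrite oppr_ge0 ltW// normrN opprK => /(_ isT); rewrite [X in _ <= X + _]addrC.
rewrite ger0_norm// [Num.max (Num.min (- t) M) 0]max_r; last first.
  by rewrite ge_min oppr_le0 t0.
rewrite expR0 max_l; last by rewrite le_min t0.
have : Num.min t M <= t by rewrite ge_min lexx.
by set y := Num.min t M; lra.
Qed.

(** The truncations e^min(|phi|, n) satisfy the bound by the estimates for phi and
- phi, and monotone convergence removes the truncation; in particular the
integrability of e^|phi| is a conclusion. *)
Lemma exp_abs_le a b phi eps : a < b -> 0 <= eps < 1 ->
  sq_integrable a b phi -> osc_le eps a b phi ->
  \int[mu]_(x in `[a, b]) phi x = 0 ->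
  (\int[mu]_(x in `[a, b]) (expR `|phi x|)%:E <=
   ((1 - eps ^+ 2 / 2) / (1 - eps) * (b - a))%:E)%E.
Proof.
move=> ab eps01 iphi osc mean; have /andP[eps0 eps1] := eps01.
have aa : a <= a by []. have bb : b <= b by [].
have mphi := iphi.1.
have e0 : 0 < 1 - eps by rewrite subr_gt0.
have sq := Rintegral_sq_le ab iphi osc mean.
have nrm := Rintegral_norm_le ab eps0 iphi sq.
set B := (_ / _ * _).
have mg n : measurable_fun (`[a, b] : set R) (fun x => expR (Num.min `|phi x| n%:R)).
  apply: (measurableT_comp (f := @expR R)); first exact: measurable_expR.
  have mM : measurable_fun (`[a, b] : set R) (fun=> n%:R : R) by [].
  have mN : measurable_fun (`[a, b] : set R) (fun x => `|phi x|) by exact: measurableT_comp.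
  exact: (measurable_minr mN mM).
have ig n : mu.-integrable (`[a, b] : set R) (EFin \o (fun x => expR (Num.min `|phi x| n%:R))).
  refine (le_integrable _ _ _ (integrable_cst_seg a b (expR n%:R))) => //.
    by apply/measurable_EFinP; exact: mg.
  move=> x _ /=; rewrite lee_fin [leLHS]ger0_norm ?expR_ge0//.
  rewrite [leRHS]ger0_norm ?expR_ge0// ler_expR.
  by rewrite ge_min lexx orbT.
have bound n : \int[mu]_(x in `[a, b]) expR (Num.min `|phi x| n%:R) <= B.
  have n0 : (0 : R) <= n%:R by [].
  pose q (f : R -> R) x := expR (Num.max (Num.min (f x) n%:R) 0) - 1 -
    Num.max (Num.min (f x) n%:R) 0.
  have iophi := sq_integrable_opp iphi.
  have omean : \int[mu]_(x in `[a, b]) - phi x = 0.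
    have -> : \int[mu]_(x in `[a, b]) - phi x = \int[mu]_(x in `[a, b]) (-1 * phi x).
      by apply: eq_Rintegral => x _; rewrite mulN1r.
    by rewrite RintegralZl// ?mean ?mulr0//; exact: sq_integrable_id iphi aa bb.
  have mle : \int[mu]_(x in `[a, b]) phi x <= 0 by rewrite mean.
  have omle : \int[mu]_(x in `[a, b]) - phi x <= 0 by rewrite omean.
  have H1 := exp_pos_part_le ab eps01 n0 iphi osc mle.
  have H2 := exp_pos_part_le ab eps01 n0 iophi (osc_le_opp osc) omle.
  have i1 := sq_integrable_exp n0 iphi.
  have i2 := sq_integrable_exp n0 iophi.
  have i3 := integrable_norm (sq_integrable_id iphi aa bb).
  have i13 := integrableD _ (integrable_cst_seg a b 1) i3.
  have i123 := integrableD _ i1 i2.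
  apply: (@le_trans _ _ (\int[mu]_(x in `[a, b])
      ((q phi x + q (fun x => - phi x) x) + (1 + `|phi x|)))).
    apply: le_Rintegral => //; first exact: (integrableD _ (i123 _) (i13 _)).
    move=> x _; exact: exp_min_norm_le.
  rewrite RintegralD//; [|exact: i123|exact: i13].
  rewrite RintegralD// (RintegralD _ (integrable_cst_seg a b 1) i3)//.
  rewrite Rintegral_seg_cst ?(ltW ab)//.
  apply: (le_trans (lerD (lerD H1 H2) (lerD (lexx _) nrm))).
  rewrite -mulrDr -RintegralD//; last 2 first.
  - have := sq_integrable_pos_part2 0 iphi aa bb; congr (_.-integrable _ _).
    by apply/funext => x /=; rewrite subr0.
  - have := sq_integrable_pos_part2 0 iophi aa bb; congr (_.-integrable _ _).
    by apply/funext => x /=; rewrite subr0.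
  have -> : \int[mu]_(x in `[a, b]) (Num.max (phi x) 0 ^+ 2 + Num.max (- phi x) 0 ^+ 2) =
      \int[mu]_(x in `[a, b]) phi x ^+ 2.
    apply: eq_Rintegral => x _; rewrite [Num.max (- _) _]maxC -{2}oppr0 -oppr_min.
    by case: (leP (phi x) 0) => _; rewrite ?oppr0 ?sqrrN ?expr0n/= ?addr0 ?add0r.
  have : (2 * (1 - eps))^-1 * \int[mu]_(x in `[a, b]) phi x ^+ 2 <=
      (2 * (1 - eps))^-1 * (eps ^+ 2 * (b - a)).
    by rewrite ler_pM2l ?invr_gt0 ?mulr_gt0.
  have -> : B = (2 * (1 - eps))^-1 * (eps ^+ 2 * (b - a)) + (1 * (b - a) + eps * (b - a)).
    have h : (b - a) * (1 + eps) = (b - a) * (1 + eps) * ((1 - eps)^-1 * (1 - eps)).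
      by rewrite mulVf ?mulr1// gt_eqF.
    by rewrite /B invfM; move: h; set j := (1 - eps)^-1; clear; lra.
  by rewrite lerD2r.
have -> : (\int[mu]_(x in `[a, b]) (expR `|phi x|)%:E =
    \int[mu]_(x in `[a, b]) limn (fun n => (expR (Num.min `|phi x| n%:R))%:E))%E.
  apply: eq_integral => x _; apply/esym/cvg_lim => //.
  apply: cvg_near_cst; near=> n; rewrite min_l//.
  by near: n; exact: nbhs_infty_ger.
rewrite monotone_convergence//.
- apply: lime_le.
    apply: ereal_nondecreasing_is_cvgn => m n mn.
    rewrite !EFin_Rintegral// lee_fin; apply: le_Rintegral => // x _.
    by rewrite ler_expR le_min ge_min lexx /= ge_min ler_nat mn orbT.
  by apply: nearW => n; rewrite EFin_Rintegral// lee_fin.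
- by move=> n; apply/measurable_EFinP; exact: mg.
- move=> x _ m n mn; rewrite lee_fin ler_expR.
  by rewrite le_min ge_min lexx /= ge_min ler_nat mn orbT.
Unshelve. all: by end_near. Qed.

End ExpAbs.

(** * Mean oscillation as a variance *)

Section Bridge.
Context {R : realType}.
Implicit Types (a b c d : R) (J Q : set R) (phi : R -> R).

(** Membership of the endpoints is left open, since it affects no integral; this
allows all integrals to be taken over the closed segment. *)
Definition has_endpoints J c d :=
  exists s t, J = [set` Interval (BSide s c) (BSide t d)].

Lemma bdd_interval_endpoints J : bdd_interval J ->
  exists c d, c < d /\ has_endpoints J c d.
Proof.
move=> [/is_intervalP JE bJ muJ].
have [M [_ /(_ (M + 1))]] := bJ; rewrite ltrDl ltr01 => /(_ isT) JM.
have lJ : has_lbound J by exists (- (M + 1)) => x /JM /=; rewrite ler_norml => /andP[].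
have uJ : has_ubound J by exists (M + 1) => x /JM /=; rewrite ler_norml => /andP[].
move: JE; rewrite /Rhull (asboolT lJ) (asboolT uJ) => JE.
exists (inf J), (sup J); split; last by eexists; eexists; exact: JE.
move: muJ; rewrite {1}JE lebesgue_measure_itv /= lte_fin.
by case: ifPn; rewrite ?ltxx.
Qed.

Lemma has_endpoints_oo c d : has_endpoints `]c, d[ c d.
Proof. by exists false, true. Qed.

Lemma bdd_interval_oo c d : c < d -> bdd_interval (`]c, d[ : set R).
Proof.
move=> cd; split.
- exact: interval_is_interval.
- exists (`|c| + `|d|); split; first by rewrite num_real.
  move=> M Mcd x /=; rewrite in_itv /= => /andP[cx xd].
  have := ler_norm d; have := ler_norm (- c); rewrite normrN => h1 h2.
  have := normr_ge0 c; have := normr_ge0 d => h3 h4.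
  by rewrite ler_norml; apply/andP; split; lra.
- by rewrite lebesgue_measure_itv /= lte_fin cd -EFinB lte_fin subr_gt0.
Qed.

Lemma has_endpoints_sub J c d : has_endpoints J c d -> `]c, d[ `<=` J /\ J `<=` `[c, d].
Proof.
by move=> [s [t ->]]; split; apply: subset_itv => //; case: s; case: t; rewrite bnd_simp.
Qed.

Lemma has_endpoints_le Q J a b c d : has_endpoints Q a b -> has_endpoints J c d ->
  c < d -> J `<=` Q -> a <= c /\ d <= b.
Proof.
move=> /has_endpoints_sub[_ Qab] /has_endpoints_sub[Jcd _] cd JQ.
have sub x : c < x < d -> a <= x <= b.
  by move=> xcd; have := Qab x (JQ x (Jcd x _)); rewrite /= !in_itv /=; apply.
split; rewrite leNgt; apply/negP => h.
- have [k1 k2] : c < (c + Num.min a d) / 2 < d /\ (c + Num.min a d) / 2 < a.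
    by case: (leP a d) => ?; split; lra.
  by have /andP[] := sub _ k1; rewrite leNgt k2.
- have [k1 k2] : c < (d + Num.max b c) / 2 < d /\ b < (d + Num.max b c) / 2.
    by case: (leP b c) => ?; split; lra.
  by have /andP[_] := sub _ k1; rewrite leNgt k2.
Qed.

Lemma measurable_endpoints J c d : has_endpoints J c d -> measurable J.
Proof. by move=> [s [t ->]]; exact: measurable_itv. Qed.

Lemma integral_endpoints J c d (f : R -> \bar R) : has_endpoints J c d ->
  measurable_fun (`[c, d] : set R) f ->
  (\int[mu]_(x in J) f x = \int[mu]_(x in `[c, d]) f x)%E.
Proof.
move=> [s [t ->]] mf.
have mf' : measurable_fun (`]c, d[ : set R) f.
  by apply: measurable_funS mf => //; exact: subset_itv_oo_cc.
by rewrite !integral_itv_bndoo.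
Qed.

Lemma lebesgue_measure_endpoints J c d : c < d -> has_endpoints J c d ->
  mu J = (d - c)%:E.
Proof. by move=> cd [s [t ->]]; rewrite lebesgue_measure_itv /= lte_fin cd EFinB. Qed.

Lemma avg_endpoints J c d f : c < d -> has_endpoints J c d ->
  measurable_fun (`[c, d] : set R) f ->
  avg J f = (((d - c)^-1)%:E * \int[mu]_(x in `[c, d]) (f x)%:E)%E.
Proof.
move=> cd Jcd mf; rewrite /avg (lebesgue_measure_endpoints cd Jcd).
rewrite (integral_endpoints Jcd); last exact/measurable_EFinP.
by rewrite inver gt_eqF// subr_gt0.
Qed.

Definition seg_mean c d phi := (d - c)^-1 * \int[mu]_(x in `[c, d]) phi x.

Lemma avg_Rintegral J c d phi : c < d -> has_endpoints J c d ->
  mu.-integrable (`[c, d] : set R) (EFin \o phi) ->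
  avg J phi = (seg_mean c d phi)%:E.
Proof.
move=> cd Jcd iphi; rewrite (avg_endpoints cd Jcd) ?EFin_Rintegral//.
by case/integrableP : iphi => /measurable_EFinP.
Qed.

Definition seg_variance c d phi := seg_mean c d (fun x => phi x ^+ 2) - seg_mean c d phi ^+ 2.

Lemma mean_mul c d phi : c < d ->
  \int[mu]_(x in `[c, d]) phi x = seg_mean c d phi * (d - c).
Proof.
by move=> cd; rewrite /seg_mean mulrC mulrA divff ?mul1r// gt_eqF// subr_gt0.
Qed.

Lemma Rintegral_sub_mean c d phi : c < d -> sq_integrable c d phi ->
  \int[mu]_(x in `[c, d]) (phi x - seg_mean c d phi) = 0.
Proof.
move=> cd iphi; rewrite RintegralB//.
- by rewrite Rintegral_seg_cst ?ltW// mean_mul// subrr.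
- exact: sq_integrable_id iphi (lexx c) (lexx d).
- exact: integrable_cst_seg.
Qed.

Lemma variance_eq c d phi : c < d -> sq_integrable c d phi ->
  \int[mu]_(x in `[c, d]) (phi x - seg_mean c d phi) ^+ 2 = seg_variance c d phi * (d - c).
Proof.
move=> cd iphi; have cd' := ltW cd.
have := Rintegral_sq_shift 0 (seg_mean c d phi) iphi (lexx c) cd' (lexx d).
rewrite Rintegral_sub_mean// mulr0 addr0 subr0.
have -> : \int[mu]_(x in `[c, d]) (phi x - 0) ^+ 2 = \int[mu]_(x in `[c, d]) phi x ^+ 2.
  by apply: eq_Rintegral => x _; rewrite subr0.
by rewrite mean_mul// /seg_variance mulrBl => ->; rewrite addrK.
Qed.

Lemma variance_le c d phi k : c < d -> sq_integrable c d phi ->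
  seg_variance c d phi * (d - c) <= \int[mu]_(x in `[c, d]) (phi x - k) ^+ 2.
Proof.
move=> cd iphi; rewrite (Rintegral_sq_shift k (seg_mean c d phi) iphi)//; last exact: ltW.
rewrite variance_eq// Rintegral_sub_mean// mulr0 addr0 lerDl.
by rewrite mulr_ge0 ?sqr_ge0// subr_ge0 ltW.
Qed.

Lemma mean_oscillation_endpoints J c d phi : c < d -> has_endpoints J c d ->
  sq_integrable c d phi ->
  mean_oscillation J phi = (Num.sqrt (seg_variance c d phi))%:E.
Proof.
move=> cd Jcd iphi; rewrite /mean_oscillation.
rewrite !(avg_Rintegral cd Jcd)//; last 2 first.
- exact: sq_integrable_id iphi _ _.
- exact: iphi.2.
Qed.

Lemma bmo_norm_ge Q phi : bdd_interval Q -> (mean_oscillation Q phi <= bmo_norm Q phi)%E.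
Proof. by move=> Qi; apply: ereal_sup_ubound; exists Q => //; split. Qed.

Lemma bmo_norm_ge0 Q phi : bdd_interval Q -> (0 <= bmo_norm Q phi)%E.
Proof. by move=> Qi; apply: le_trans (bmo_norm_ge phi Qi); exact: sqrte_ge0. Qed.

(** Q is among its own subintervals: were phi^2 not integrable, the mean
oscillation over Q, and with it the norm, would be infinite. *)
Lemma BMO_sq_integrable Q a b phi : bdd_interval Q -> a < b -> has_endpoints Q a b ->
  BMO Q phi -> sq_integrable a b phi.
Proof.
move=> Qi ab Qab [iphi bmo].
have mphi : measurable_fun (`[a, b] : set R) phi.
  case: Qab iphi => s [t ->] /integrableP[/measurable_EFinP mphi _].
  exact: measurable_fun_itv_cc mphi.
have mphi2 : measurable_fun (`[a, b] : set R) (fun x => phi x ^+ 2) by exact: measurable_funX.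
have iphi' : mu.-integrable (`[a, b] : set R) (EFin \o phi).
  apply/integrableP; split; first exact/measurable_EFinP.
  move/integrableP : iphi => [_]; rewrite (integral_endpoints Qab)//.
  by apply: measurableT_comp => //; exact/measurable_EFinP.
split=> //; apply/integrableP; split; first exact/measurable_EFinP.
have -> : (\int[mu]_(x in `[a, b]) `|(EFin \o (fun x => phi x ^+ 2)%R) x| =
    \int[mu]_(x in `[a, b]) (phi x ^+ 2)%:E)%E.
  by apply: eq_integral => x _; rewrite /= ger0_norm ?sqr_ge0.
rewrite ltey; apply/eqP => infty.
have := le_lt_trans (bmo_norm_ge phi Qi) bmo.
rewrite /mean_oscillation (avg_endpoints ab Qab mphi2) infty (avg_Rintegral ab Qab iphi').
by rewrite gt0_muley ?lte_fin ?invr_gt0 ?subr_gt0.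
Qed.

Lemma bmo_norm_osc_le Q a b phi eps : bdd_interval Q -> has_endpoints Q a b ->
  0 <= eps -> sq_integrable a b phi -> (bmo_norm Q phi <= eps%:E)%E ->
  osc_le eps a b phi.
Proof.
move=> Qi Qab eps0 iphi bmo c d ac cd db.
have icd : sq_integrable c d phi.
  split; last exact: integrable_seg_sub ac db iphi.2.
  by apply: measurable_funS iphi.1 => //; apply: subset_itv; rewrite bnd_simp.
exists (seg_mean c d phi); rewrite variance_eq// ler_pM2r ?subr_gt0//.
have : (mean_oscillation `]c, d[ phi <= eps%:E)%E.
  apply: le_trans bmo; apply: ereal_sup_ubound; exists `]c, d[%classic => //.
  split; first exact: bdd_interval_oo.
  apply: subset_trans (has_endpoints_sub Qab).1.
  by apply: subset_itv; rewrite bnd_simp.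
rewrite (mean_oscillation_endpoints cd (has_endpoints_oo c d) icd) lee_fin.
have [v0 vs|v0 _] := leP 0 (seg_variance c d phi).
  by rewrite -(sqr_sqrtr v0) ler_pXn2r// nnegrE.
by rewrite (le_trans (ltW v0))// sqr_ge0.
Qed.

Lemma bmo_norm_le Q a b phi eps : has_endpoints Q a b -> 0 <= eps ->
  (forall c d, a <= c -> c < d -> d <= b -> sq_integrable c d phi /\
     seg_variance c d phi <= eps ^+ 2) ->
  (bmo_norm Q phi <= eps%:E)%E.
Proof.
move=> Qab eps0 H; apply: ge_ereal_sup => _ [J [Ji JQ] <-].
have [c [d [cd Jcd]]] := bdd_interval_endpoints Ji.
have [ac db] := has_endpoints_le Qab Jcd cd JQ.
have [icd v] := H c d ac cd db.
rewrite (mean_oscillation_endpoints cd Jcd icd) lee_fin.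
by rewrite -(ger0_norm eps0) -sqrtr_sqr ler_wsqrtr.
Qed.

Lemma exp_avg_le Q phi eps : bdd_interval Q -> 0 <= eps < 1 -> BMO Q phi ->
  (bmo_norm Q phi <= eps%:E)%E ->
  (exp_avg Q phi <= ((1 - eps ^+ 2 / 2) / (1 - eps))%:E)%E.
Proof.
move=> Qi eps01 Qphi bmo; have /andP[eps0 _] := eps01.
have [a [b [ab Qab]]] := bdd_interval_endpoints Qi.
have iphi := BMO_sq_integrable Qi ab Qab Qphi.
have osc := bmo_norm_osc_le Qi Qab eps0 iphi bmo.
have i1 := sq_integrable_id iphi (lexx a) (lexx b).
rewrite /exp_avg (avg_Rintegral ab Qab i1) /=.
rewrite (avg_endpoints ab Qab); last first.
  apply: (measurableT_comp (f := @expR R)); first exact: measurable_expR.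
  apply: measurableT_comp => //; apply: measurable_funB => //; exact: iphi.1.
have := exp_abs_le ab eps01 (sq_integrable_translate (seg_mean a b phi) iphi)
  (osc_le_translate (seg_mean a b phi) osc) (Rintegral_sub_mean ab iphi).
rewrite lee_pdivrMl ?subr_gt0// -EFinM.
by rewrite [X in (_ <= X%:E)%E]mulrC.
Qed.

End Bridge.

(** * Integrals with singularities at the endpoints *)

Section ImproperFTC.
Context {R : realType}.
Implicit Types (c d : R) (f F : R -> R).

(** The integrand may be unbounded at the endpoints as long as its primitive is
continuous there: the classical theorem holds on the segments
[c + r n, d - r n], and for a nonnegative integrand monotone convergence lets
r n tend to 0. *)
Lemma FTC_open c d f F : c < d ->
  (forall x, c < x < d -> 0 <= f x) ->
  (forall x, c < x < d -> {for x, continuous f}) ->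
  (forall x, c < x < d -> is_derive x (1 : R) F (f x)) ->
  F x @[x --> c^'+] --> F c -> F x @[x --> d^'-] --> F d ->
  mu.-integrable (`[c, d] : set R) (EFin \o f) /\
  \int[mu]_(x in `[c, d]) f x = F d - F c.
Proof.
move=> cd f0 fc dF Fc Fd.
have mf : measurable_fun (`]c, d[ : set R) f.
  apply: open_continuous_measurable_fun; first exact: interval_open.
  by move=> x; rewrite inE /= in_itv /= => /fc.
have mf' : measurable_fun (`[c, d] : set R) f by exact: measurable_fun_itv_cc mf.
have lo : (0 : R) < (d - c) / 3 by rewrite divr_gt0// subr_gt0.
(* The factor 1/3 keeps c + r n < d - r n from the start. *)
pose r (n : nat) : R := (d - c) / 3 * harmonic n.
have r0 n : 0 < r n by rewrite mulr_gt0// /harmonic /= invr_gt0 ltr0n.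
have r1 n : r n <= (d - c) / 3.
  by rewrite /r ger_pMr// /harmonic /= invf_le1 ?ltr0n// ler1n.
have rle m n : (m <= n)%N -> r n <= r m.
  by move=> mn; rewrite /r ler_pM2l// /harmonic /= lef_pV2 ?posrE ?ltr0n// ler_nat ltnS.
have rcvg : r n @[n --> \oo] --> (0 : R).
  by rewrite -(mulr0 ((d - c) / 3)); apply: cvgMr; exact: cvg_harmonic.
have key : (\int[mu]_(x in `]c, d[) (f x)%:E = (F d - F c)%:E)%E.
  pose g n := (EFin \o f) \_ (`[c + r n, d - r n] : set R).
  have sub n : (`[c + r n, d - r n] : set R) `<=` `]c, d[.
    by move=> x /=; rewrite !in_itv /= => /andP[h1 h2]; have := r0 n => rn0; apply/andP; split; lra.
  have intg n : (\int[mu]_(x in `]c, d[) g n x = (F (d - r n) - F (c + r n))%:E)%E.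
    rewrite /g -integral_mkcondr (setIidr (@sub n)).
    have sub' x : c + r n <= x <= d - r n -> c < x < d.
      by move=> /andP[h1 h2]; have := r0 n => rn0; apply/andP; split; lra.
    have := r1 n; have := r0 n => rn0 rn1.
    rewrite (@continuous_FTC2 _ f F) ?EFinB//; first by lra.
    - apply: continuous_in_subspaceT => x; rewrite inE /= in_itv /= => /sub'; exact: fc.
    - have cF x : c < x < d -> {for x, continuous F}.
        move=> xcd; have dFx := dF x xcd.
        by apply: differentiable_continuous; apply/derivable1_diffP.
      split.
      + move=> x; rewrite in_itv /= => /andP[h1 h2].
        by have [] : is_derive x (1 : R) F (f x) by apply: dF; apply: sub'; rewrite !ltW.
      + by apply: cvg_at_right_filter; apply: cF; apply: sub'; apply/andP; split; lra.
      + by apply: cvg_at_left_filter; apply: cF; apply: sub'; apply/andP; split; lra.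
    - move=> x; rewrite in_itv /= => /andP[h1 h2]; rewrite derive1E.
      by have [] : is_derive x (1 : R) F (f x) by apply: dF; apply: sub'; rewrite !ltW.
  have -> : (\int[mu]_(x in `]c, d[) (f x)%:E = \int[mu]_(x in `]c, d[) limn (g^~ x))%E.
    apply: eq_integral => x; rewrite inE /= in_itv /= => /andP[cx xd].
    apply/esym/cvg_lim => //; apply: cvg_near_cst; near=> n.
    rewrite /g patchE ifT// inE /= in_itv /=.
    have : r n < Num.min (x - c) (d - x).
      near: n; have /cvgrPdist_lt := rcvg.
      move=> /(_ (Num.min (x - c) (d - x))); rewrite lt_min !subr_gt0 cx xd => /(_ isT).
      by apply: filterS => n; rewrite sub0r normrN gtr0_norm.
    by rewrite lt_min => /andP[h1 h2]; apply/andP; split; lra.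
  rewrite monotone_convergence//.
  - under eq_fun do rewrite intg.
    apply/cvg_lim => //; apply: cvg_EFin; first exact: nearW.
    apply: cvgB.
    + move/cvg_at_leftP : Fd; apply; split; first by move=> n; rewrite ltrBlDr ltrDl.
      by rewrite -[X in _ --> X]subr0; apply: cvgB => //; exact: cvg_cst.
    + move/cvg_at_rightP : Fc; apply; split; first by move=> n; rewrite ltrDl.
      by rewrite -[X in _ --> X]addr0; apply: cvgD => //; exact: cvg_cst.
  - move=> n; apply/measurable_restrict => //.
    by rewrite (setIidr (@sub n)); apply/measurable_EFinP; exact: measurable_funS mf.
  - move=> n x; rewrite /= in_itv /= => /f0 ?; rewrite /g patchE.
    by case: ifPn => _; rewrite ?lee_fin.
  - move=> x; rewrite /= in_itv /= => /f0 fx0 m n mn; rewrite /g !patchE.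
    case: ifPn => h; last by case: ifPn => _; rewrite ?lee_fin.
    rewrite ifT//; move: h; rewrite !inE /= !in_itv /= => /andP[h1 h2].
    by have := rle _ _ mn => rmn; apply/andP; split; lra.
have fi : mu.-integrable (`[c, d] : set R) (EFin \o f).
  apply/integrableP; split; first exact/measurable_EFinP.
  rewrite (@integral_itv_bndoo _ _ _ _ true false); last first.
    by apply: measurableT_comp => //; exact/measurable_EFinP.
  under eq_integral => x.
    rewrite inE /= in_itv /= => xcd; rewrite ger0_norm ?f0//; over.
  by rewrite key ltry.
split => //; rewrite /Rintegral (@integral_itv_bndoo _ _ _ _ true false) ?key//.
exact/measurable_EFinP.
Unshelve. all: by end_near. Qed.

End ImproperFTC.

(** * Integrals of functions of a logarithm *)

Section LogIntegrals.
Context {R : realType}.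
Implicit Types (p q : R -> R).

(** For t = e^y with y <= 0 the product is at most C e^((1 - th) y), which tends
to 0 as y tends to - oo because th < 1. *)
Lemma continuous_mul_ln0 p (C th : R) : 0 < C -> th < (1 : R) ->
  (forall y, y <= 0 -> `|p y| <= C * expR (- th * y)) ->
  {for (0 : R), continuous (fun t : R => t * p (ln t))}.
Proof.
move=> C0 th1 pC; have th0 : 0 < 1 - th by rewrite subr_gt0.
suff H : t * p (ln t) @[t --> (0 : R)] --> (0 : R) by rewrite /prop_for /continuous_at mul0r.
have small (r : R) : 0 < r -> \forall t \near (0 : R), `|t| < r.
  by move=> r0; exists r => // t; rewrite /= sub0r normrN.
apply/cvgrPdist_lt => e e0.
have e1 : 0 < e / C by rewrite divr_gt0.
near=> t; rewrite sub0r normrN.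
have te : `|t| < e / C.
  by near: t; exact: small.
have [t0|t0] := leP t 0.
  rewrite ln0//; have := pC 0 (lexx 0); rewrite mulr0 expR0 mulr1 normrM => p0.
  rewrite (@le_lt_trans _ _ (`|t| * C))//; first by rewrite ler_wpM2l.
  by rewrite -ltr_pdivlMr.
have t1 : t < 1.
  by apply: le_lt_trans (ler_norm t) _; near: t; exact: small.
have lnt : ln t <= 0 by rewrite ln_le0// ltW.
have tl : t < expR (ln (e / C) / (1 - th)).
  apply: le_lt_trans (ler_norm t) _; near: t; apply: small; exact: expR_gt0.
rewrite normrM (gtr0_norm t0).
rewrite (@le_lt_trans _ _ (t * (C * expR (- th * ln t))))//.
  by apply: ler_wpM2l; [exact: ltW|exact: pC].
rewrite mulrCA -{1}(lnK t0) -expRD mulrC -ltr_pdivlMr// -[ltRHS](lnK e1) ltr_expR.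
have -> : ln t + - th * ln t = (1 - th) * ln t by lra.
by rewrite mulrC -ltr_pdivlMr// -ltr_expR lnK.
Unshelve. all: by end_near. Qed.

Variables (p q : R -> R) (C th : R).
Hypothesis C0 : 0 < C.
Hypothesis th1 : th < 1.
Hypothesis pC : forall y, y <= 0 -> `|p y| <= C * expR (- th * y).
Hypothesis qc : continuous q.
Hypothesis dp : forall y : R, is_derive y (1 : R) p (q y - p y).

Lemma is_derive_mul_ln (t : R) : 0 < t ->
  is_derive t (1 : R) (fun t : R => t * p (ln t)) (q (ln t)).
Proof.
move=> t0; have dln := is_derive1_ln t0.
have dpl : is_derive t (1 : R) (p \o @ln R) ((q (ln t) - p (ln t)) * t^-1).
  exact: is_derive1_comp.
apply: (@is_derive_eq _ _ _ _ _ _ _ _ (is_deriveM (is_derive_id t 1) dpl)).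
rewrite /GRing.scale /= mulr1 mulrC mulfVK ?gt_eqF//; lra.
Qed.

Lemma continuous_mul_ln (t : R) : 0 <= t -> {for t, continuous (fun t : R => t * p (ln t))}.
Proof.
rewrite le_eqVlt => /predU1P[<-|t0]; first exact: continuous_mul_ln0 pC.
have dt := is_derive_mul_ln t0.
by apply: differentiable_continuous; apply/derivable1_diffP.
Qed.

(** If p' = q - p then t p(ln t) is a primitive of q(ln t).  The orientation s is
1 for the distance s (x - o) to a left endpoint o and - 1 for the distance to
a right endpoint; the factor s of the distance cancels that of the chain rule,
which leaves x - o in front of p. *)
Lemma FTC_ln (s o L c e : R) : s * s = 1 -> 0 < L -> c < e ->
  (forall x, c < x < e -> 0 < s * (x - o)) ->
  0 <= s * (c - o) -> 0 <= s * (e - o) ->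
  (forall x, c < x < e -> 0 <= q (ln (s * (x - o) / L))) ->
  mu.-integrable (`[c, e] : set R) (EFin \o (fun x => q (ln (s * (x - o) / L)))) /\
  \int[mu]_(x in `[c, e]) q (ln (s * (x - o) / L)) =
  (e - o) * p (ln (s * (e - o) / L)) - (c - o) * p (ln (s * (c - o) / L)).
Proof.
move=> ss L0 ce upos uc ue q0.
pose h t := t * p (ln t).
pose u x := s * (x - o) / L.
pose F x := s * L * h (u x).
have du (x : R) : is_derive x (1 : R) u (s / L).
  by apply: is_derive_eq; rewrite /GRing.scale /=; lra.
have uc' x : {for x, continuous u}.
  by have dux := du x; apply: differentiable_continuous; apply/derivable1_diffP.
have FE x : F x = (x - o) * p (ln (s * (x - o) / L)).
  rewrite /F /h /u; set P := p _.
  have -> : s * L * (s * (x - o) / L * P) = s * s * (L / L) * (x - o) * P by lra.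
  by rewrite ss divff ?gt_eqF// !mul1r.
rewrite -!FE.
have Fc x : 0 <= s * (x - o) -> {for x, continuous F}.
  move=> ux; apply: (@continuousM _ _ (fun=> s * L)); first exact: cst_continuous.
  apply: (@continuous_comp _ _ _ u h) => //.
  by apply: continuous_mul_ln; rewrite divr_ge0// ltW.
have dF x : c < x < e -> is_derive x (1 : R) F (q (ln (u x))).
  move=> /upos ux; have ux' : 0 < u x by rewrite divr_gt0.
  have dhu := is_derive1_comp (is_derive_mul_ln ux') (du x).
  have dF : is_derive x (1 : R) (s * L *: (h \o u)) (s * L *: (q (ln (u x)) * (s / L))).
    exact: is_deriveZ.
  apply: (is_derive_eq dF); rewrite /GRing.scale /=.
  have -> : s * L * (q (ln (u x)) * (s / L)) = s * s * (L / L) * q (ln (u x)) by lra.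
  by rewrite ss divff ?gt_eqF// !mul1r.
have qlc x : c < x < e -> {for x, continuous (fun x => q (ln (u x)))}.
  move=> /upos ux; have ux' : 0 < u x by rewrite divr_gt0.
  apply: (@continuous_comp _ _ _ u (q \o @ln R)); first exact: uc'.
  apply: (@continuous_comp _ _ _ (@ln R) q); first exact: continuous_ln.
  exact: qc.
apply: (FTC_open ce q0 qlc dF).
- by apply: cvg_at_right_filter; exact: Fc.
- by apply: cvg_at_left_filter; exact: Fc.
Qed.

End LogIntegrals.

Section LogInstances.
Context {R : realType}.
Variables (s o L c e : R).
Hypothesis ss : s * s = 1.
Hypothesis L0 : 0 < L.
Hypothesis ce : c < e.
Hypothesis upos : forall x, c < x < e -> 0 < s * (x - o).
Hypothesis uc : 0 <= s * (c - o).
Hypothesis ue : 0 <= s * (e - o).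

Let lg x : R := ln (s * (x - o) / L).

Lemma FTC_ln_sq k :
  mu.-integrable (`[c, e] : set R) (EFin \o (fun x => (lg x - k) ^+ 2)) /\
  \int[mu]_(x in `[c, e]) (lg x - k) ^+ 2 =
  (e - o) * ((lg e - k - 1) ^+ 2 + 1) - (c - o) * ((lg c - k - 1) ^+ 2 + 1).
Proof.
apply: (@FTC_ln R (fun y => (y - k - 1) ^+ 2 + 1) (fun y => (y - k) ^+ 2)
  (33 + 2 * (k + 1) ^+ 2) (1 / 2)) => //.
- by rewrite ltr_wpDr// mulr_ge0// sqr_ge0.
- by lra.
- move=> y y0; rewrite ger0_norm ?addr_ge0 ?sqr_ge0//.
  (* The square of e^(|y| / 4) >= 1 + |y| / 4 gives
     y^2 <= 16 e^(|y| / 2), while (y - k - 1)^2 <= 2 y^2 + 2 (k + 1)^2. *)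
  have E1 : expR (- (1 / 2) * y) = expR (- y / 4) ^+ 2.
    by rewrite expr2 -expRD; congr expR; lra.
  have h1 := expR_ge1Dx (- y / 4).
  have h2 : (1 + - y / 4) ^+ 2 <= expR (- (1 / 2) * y).
    by rewrite E1 ler_pXn2r// ?nnegrE; lra.
  have h3 : 1 <= expR (- (1 / 2) * y) by nra.
  have := sqr_ge0 (y + k + 1); have := sqr_ge0 (k + 1).
  move: h2 h3; set E := expR _; set K := (k + 1) ^+ 2 => h2 h3 K0.
  have : K <= K * E by rewrite ler_peMr.
  have -> : (y - k - 1) ^+ 2 = 2 * y ^+ 2 + 2 * K - (y + k + 1) ^+ 2 by rewrite /K; lra.
  by nra.
- move=> y; apply: (@continuous_comp _ _ _ (fun y => y - k) (fun y => y ^+ 2));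
    last exact: exprn_continuous.
  by apply: continuousB => //; exact: cst_continuous.
- by move=> y; apply: is_derive_eq; rewrite /GRing.scale /=; lra.
- by move=> x _; exact: sqr_ge0.
Qed.

Lemma FTC_ln_opp : (forall x, c < x < e -> lg x <= 0) ->
  mu.-integrable (`[c, e] : set R) (EFin \o (fun x => - lg x)) /\
  \int[mu]_(x in `[c, e]) - lg x =
  (e - o) * (1 - lg e) - (c - o) * (1 - lg c).
Proof.
move=> lg0; apply: (@FTC_ln R (fun y => 1 - y) (fun y => - y) 2 (1 / 2)) => //.
- by lra.
- move=> y y0; rewrite ger0_norm; last by lra.
  by have := expR_ge1Dx (- (1 / 2) * y); lra.
- by move=> y; exact: opp_continuous.
- by move=> y; apply: is_derive_eq; rewrite /GRing.scale /=; lra.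
- by move=> x /lg0; rewrite oppr_ge0.
Qed.

Lemma FTC_ln_exp t : t < 1 ->
  mu.-integrable (`[c, e] : set R) (EFin \o (fun x => expR (- t * lg x))) /\
  \int[mu]_(x in `[c, e]) expR (- t * lg x) =
  (e - o) * (expR (- t * lg e) / (1 - t)) - (c - o) * (expR (- t * lg c) / (1 - t)).
Proof.
move=> t1; have t0 : 0 < (1 - t)^-1 by rewrite invr_gt0 subr_gt0.
apply: (@FTC_ln R (fun y => expR (- t * y) / (1 - t)) (fun y => expR (- t * y))
  (1 - t)^-1 t) => //.
- by move=> y y0; rewrite ger0_norm ?mulr_ge0 ?expR_ge0// ?(ltW t0)// mulrC.
- move=> y; apply: (@continuous_comp _ _ _ (fun y => - t * y) expR).
    exact: mulrl_continuous.
  exact: continuous_expR.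
- move=> y; apply: is_derive_eq; rewrite /GRing.scale /=.
  have h : (1 - t) * (1 - t)^-1 = 1 by rewrite divff// gt_eqF// subr_gt0.
  have -> : expR (- t * y) - expR (- t * y) / (1 - t) =
    expR (- t * y) * ((1 - t) * (1 - t)^-1) - expR (- t * y) / (1 - t) by rewrite h mulr1.
  by lra.
Qed.

(** The logarithm has variance at most 1 on every interval of a half-line: for the
constant k chosen below, which is the mean, the integral equals
(e - c) - (e - o) (c - o) (e - c) w^2, where w is the difference quotient of
the logarithm. *)
Lemma ln_osc : exists k,
  mu.-integrable (`[c, e] : set R) (EFin \o (fun x => (lg x - k) ^+ 2)) /\
  \int[mu]_(x in `[c, e]) (lg x - k) ^+ 2 <= e - c.
Proof.
pose i := (e - c)^-1.
have hi : (e - c) * i = 1 by rewrite /i divff// gt_eqF// subr_gt0.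
have ec0 : 0 <= e - c by rewrite subr_ge0 ltW.
(* The mean of lg, from the primitive (x - o) (lg x - 1). *)
pose k := ((e - o) * lg e - (c - o) * lg c) * i - 1.
pose w := (lg e - lg c) * i.
exists k; have [ik ->] := FTC_ln_sq k; split => //.
have -> : lg e - k - 1 = - (c - o) * w.
  have -> : lg e - k - 1 = lg e * ((e - c) * i) - ((e - o) * lg e - (c - o) * lg c) * i.
    by rewrite hi /k; lra.
  by rewrite /w; lra.
have -> : lg c - k - 1 = - (e - o) * w.
  have -> : lg c - k - 1 = lg c * ((e - c) * i) - ((e - o) * lg e - (c - o) * lg c) * i.
    by rewrite hi /k; lra.
  by rewrite /w; lra.
have h : 0 <= (e - o) * (c - o).
  by have := mulr_ge0 ue uc; rewrite mulrACA ss mul1r.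
have := mulr_ge0 (mulr_ge0 h ec0) (sqr_ge0 w).
by lra.
Qed.

End LogInstances.

(** * The two-sided logarithm *)

Section Example.
Context {R : realType}.

Definition logp (t : R) : R := Num.max (- ln t) 0.

(** The factors 1 and - 1 are the orientations of FTC_ln at the two endpoints. *)
Definition two_sided_log (a b x : R) : R :=
  logp (1 * (x - a) / ((b - a) / 4)) - logp (- 1 * (x - b) / ((b - a) / 4)).

Variables (a b : R).
Hypothesis ab : a < b.
Let L : R := (b - a) / 4.
Let phi := two_sided_log a b.
Let lu (x : R) : R := ln (1 * (x - a) / L).
Let lv (x : R) : R := ln (- 1 * (x - b) / L).

Let hL : 4 * L = b - a. Proof. by rewrite /L; lra. Qed.
Let L0 : 0 < L. Proof. by have := hL; have := ab; lra. Qed.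

Let logp0 (t : R) : 1 <= t -> logp t = 0.
Proof. by move=> t1; rewrite /logp max_r// oppr_le0 ln_ge0. Qed.

Let logpN (t : R) : t <= 1 -> logp t = - ln t.
Proof. by move=> t1; rewrite /logp max_l// oppr_ge0 ln_le0. Qed.

Let phi_u x : x <= b - L -> phi x = logp (1 * (x - a) / L).
Proof.
move=> xb; rewrite /phi /two_sided_log -/L [X in _ - X]logp0 ?subr0//.
by rewrite ler_pdivlMr//; lra.
Qed.

Let phi_v x : a + L <= x -> phi x = - logp (- 1 * (x - b) / L).
Proof.
move=> xb; rewrite /phi /two_sided_log -/L [X in X - _]logp0 ?sub0r//.
by rewrite ler_pdivlMr//; lra.
Qed.

Let phi_l x : x <= a + L -> phi x = - lu x.
Proof.
move=> xb; rewrite phi_u ?logpN//; last by have := hL; have := L0; lra.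
by rewrite ler_pdivrMr//; lra.
Qed.

Let phi_r x : b - L <= x -> phi x = lv x.
Proof.
move=> xb; rewrite phi_v ?logpN ?opprK//; last by have := hL; have := L0; lra.
by rewrite ler_pdivrMr//; lra.
Qed.

Let phi_m x : a + L <= x -> x <= b - L -> phi x = 0.
Proof. by move=> ax xb; rewrite phi_u// logp0// ler_pdivlMr//; lra. Qed.

Let s1 : 1 * 1 = 1 :> R. Proof. by rewrite mulr1. Qed.
Let s2 : - 1 * - 1 = 1 :> R. Proof. by rewrite mulrNN mulr1. Qed.

Let upos c e : a <= c -> forall x, c < x < e -> 0 < 1 * (x - a).
Proof. by move=> ac x /andP[cx _]; lra. Qed.

Let vpos c e : e <= b -> forall x, c < x < e -> 0 < - 1 * (x - b).
Proof. by move=> eb x /andP[_ xe]; lra. Qed.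

Let u0 c : a <= c -> 0 <= 1 * (c - a). Proof. by move=> ac; lra. Qed.
Let v0 c : c <= b -> 0 <= - 1 * (c - b). Proof. by move=> ac; lra. Qed.

Let lu1 : lu (a + L) = 0.
Proof. by rewrite /lu addrAC subrr add0r mul1r divff ?ln1// gt_eqF. Qed.

Let lv1 : lv (b - L) = 0.
Proof. by rewrite /lv addrAC subrr add0r mulrN mulN1r opprK divff ?ln1// gt_eqF. Qed.

Let mphi : measurable_fun setT phi.
Proof.
have mlogp : measurable_fun setT logp.
  have h1 : measurable_fun setT (fun t : R => - ln t).
    by apply: measurable_funN; exact: measurable_ln.
  have h2 : measurable_fun setT (fun _ : R => 0 : R) by [].
  exact: (measurable_maxr h1 h2).
have maff (s o : R) : measurable_fun setT (fun x : R => s * (x - o) / L).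
  by apply: measurable_funM => //; apply: measurable_funM => //; exact: measurable_funB.
apply: measurable_funB; [exact: (measurableT_comp mlogp (maff 1 a))|
  exact: (measurableT_comp mlogp (maff (- 1) b))].
Qed.

Let phi_sq_le x : phi x ^+ 2 <= lu x ^+ 2 + lv x ^+ 2.
Proof.
have := sqr_ge0 (lu x); have := sqr_ge0 (lv x).
have [xb|xb] := leP x (b - L).
  by rewrite phi_u// /logp -/(lu x); case: (leP (- lu x) 0) => _; rewrite ?sqrrN ?expr0n /=; lra.
rewrite phi_v; last by have := hL; have := L0; lra.
by rewrite /logp sqrrN -/(lv x); case: (leP (- lv x) 0) => _; rewrite ?sqrrN ?expr0n /=; lra.
Qed.

Lemma two_sided_log_sq_integrable : sq_integrable a b phi.
Proof.
split; first exact: measurable_funTS.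
have aa : a <= a by []. have bb : b <= b by []. have ab' := ltW ab.
have [iu _] := FTC_ln_sq s1 L0 ab (upos aa) (u0 aa) (u0 ab') 0.
have [iv _] := FTC_ln_sq s2 L0 ab (vpos bb) (v0 ab') (v0 bb) 0.
refine (le_integrable _ _ _ (integrableD _ iu iv)) => //.
  by apply/measurable_EFinP; apply: measurable_funX; exact: measurable_funTS.
move=> x _ /=; rewrite lee_fin.
rewrite !subr0 ger0_norm ?sqr_ge0// [leRHS]ger0_norm ?addr_ge0 ?sqr_ge0//.
Qed.

Let iphi := two_sided_log_sq_integrable.
Let aL : a <= a + L. Proof. by have := L0; lra. Qed.
Let aL' : a < a + L. Proof. by have := L0; lra. Qed.
Let Lb : b - L <= b. Proof. by have := L0; lra. Qed.
Let Lb' : b - L < b. Proof. by have := L0; lra. Qed.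
Let aLb : a + L <= b - L. Proof. by have := hL; have := L0; lra. Qed.
Let aLb' : a + L <= b. Proof. by have := hL; have := L0; lra. Qed.

Let split3 (f : R -> R) : mu.-integrable (`[a, b] : set R) (EFin \o f) ->
  \int[mu]_(x in `[a, b]) f x = \int[mu]_(x in `[a, a + L]) f x +
    (\int[mu]_(x in `[a + L, b - L]) f x + \int[mu]_(x in `[b - L, b]) f x).
Proof.
move=> fi; rewrite (Rintegral_seg_split aL aLb' fi); congr (_ + _).
by apply: Rintegral_seg_split => //; exact: integrable_seg_sub aL _ fi.
Qed.

Lemma two_sided_log_mean : seg_mean a b phi = 0.
Proof.
rewrite /seg_mean split3; last exact: sq_integrable_id iphi _ _.
have -> : \int[mu]_(x in `[a, a + L]) phi x = \int[mu]_(x in `[a, a + L]) - lu x.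
  by apply: eq_Rintegral => x; rewrite inE /= in_itv /= => /andP[_ /phi_l].
have -> : \int[mu]_(x in `[a + L, b - L]) phi x = \int[mu]_(x in `[a + L, b - L]) 0.
  by apply: eq_Rintegral => x; rewrite inE /= in_itv /= => /andP[h1 h2]; exact: phi_m.
have -> : \int[mu]_(x in `[b - L, b]) phi x = \int[mu]_(x in `[b - L, b]) (-1 * - lv x).
  apply: eq_Rintegral => x; rewrite inE /= in_itv /= => /andP[/phi_r -> _].
  by rewrite mulrNN mul1r.
have lu0 x : a < x < a + L -> lu x <= 0.
  by move=> /andP[_ xa]; apply: ln_le0; rewrite ler_pdivrMr//; lra.
have lv0 x : b - L < x < b -> lv x <= 0.
  by move=> /andP[xa _]; apply: ln_le0; rewrite ler_pdivrMr//; lra.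
have [iu ->] := FTC_ln_opp s1 L0 aL' (upos (lexx a)) (u0 (lexx a)) (u0 aL) lu0.
have [iv Ev] := FTC_ln_opp s2 L0 Lb' (vpos (lexx b)) (v0 Lb) (v0 (lexx b)) lv0.
rewrite RintegralZl// Ev -/(lu _) -/(lv _) -/(lv _) lu1 lv1 Rintegral_seg_cst//.
by rewrite !subrr; lra.
Qed.

Let int_sq_l c : a <= c -> c < a + L ->
  \int[mu]_(x in `[c, a + L]) phi x ^+ 2 = 2 * L - (c - a) * ((lu c - 1) ^+ 2 + 1).
Proof.
move=> ac ca.
have [_] := FTC_ln_sq s1 L0 ca (upos ac) (u0 ac) (u0 aL) 0.
rewrite -!/(lu _) lu1 !subr0.
have -> : \int[mu]_(x in `[c, a + L]) (ln (1 * (x - a) / L) - 0) ^+ 2 =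
    \int[mu]_(x in `[c, a + L]) phi x ^+ 2.
  apply: eq_Rintegral => x; rewrite inE /= in_itv /= => /andP[_ /phi_l ->].
  by rewrite subr0 sqrrN.
by move=> ->; lra.
Qed.

Let int_sq_r d : d <= b -> b - L < d ->
  \int[mu]_(x in `[b - L, d]) phi x ^+ 2 = 2 * L - (b - d) * ((lv d - 1) ^+ 2 + 1).
Proof.
move=> db bd.
have [_] := FTC_ln_sq s2 L0 bd (vpos db) (v0 Lb) (v0 db) 0.
rewrite -!/(lv _) lv1 !subr0.
have -> : \int[mu]_(x in `[b - L, d]) (ln (- 1 * (x - b) / L) - 0) ^+ 2 =
    \int[mu]_(x in `[b - L, d]) phi x ^+ 2.
  by apply: eq_Rintegral => x; rewrite inE /= in_itv /= => /andP[/phi_r -> _]; rewrite subr0.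
by move=> ->; lra.
Qed.

Let int_sq_m : \int[mu]_(x in `[a + L, b - L]) phi x ^+ 2 = 0.
Proof.
have -> : \int[mu]_(x in `[a + L, b - L]) phi x ^+ 2 = \int[mu]_(x in `[a + L, b - L]) 0.
  apply: eq_Rintegral => x; rewrite inE /= in_itv /= => /andP[h1 h2].
  by rewrite phi_m// expr0n.
by rewrite Rintegral_seg_cst// mul0r.
Qed.

Lemma two_sided_log_variance : seg_variance a b phi = 1.
Proof.
rewrite /seg_variance two_sided_log_mean expr0n /= subr0 /seg_mean split3; last exact: iphi.2.
rewrite int_sq_l// int_sq_m int_sq_r// !subrr -hL.
rewrite !mul0r !subr0 add0r.
have -> : 2 * L + 2 * L = 4 * L by lra.
by rewrite mulVf// gt_eqF// mulr_gt0.
Qed.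

(** An interval away from one of the outer quarters sees only one logarithm,
through the contraction y |-> max(- y, 0), so the constant of ln_osc is
transported by the same contraction.  An interval that meets both outer
quarters is so long that the second moment already suffices. *)
Lemma two_sided_log_osc c d : a <= c -> c < d -> d <= b ->
  exists k, \int[mu]_(x in `[c, d]) (phi x - k) ^+ 2 <= d - c.
Proof.
move=> ac cd db; have cd' := ltW cd.
have ishift k := sq_integrable_shift2 k iphi ac db.
have [dbL|dbL] := leP d (b - L).
  have [k [ik Hk]] := ln_osc s1 L0 cd (upos ac) (u0 ac) (u0 (le_trans ac cd')).
  exists (Num.max (- k) 0); apply: le_trans Hk; apply: le_Rintegral => //.
  move=> x; rewrite /= in_itv /= => /andP[_ xd].
  rewrite phi_u ?(le_trans xd)// /logp -/(lu x); have := sqr_ge0 (lu x - k).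
  by case: (leP (- lu x) 0) => ?; case: (leP (- k) 0) => ?; nra.
have [caL|caL] := leP (a + L) c.
  have [k [ik Hk]] := ln_osc s2 L0 cd (vpos db) (v0 (le_trans cd' db)) (v0 db).
  exists (- Num.max (- k) 0); apply: le_trans Hk; apply: le_Rintegral => //.
  move=> x; rewrite /= in_itv /= => /andP[cx _].
  rewrite phi_v ?(le_trans caL)// /logp -/(lv x); have := sqr_ge0 (lv x - k).
  by case: (leP (- lv x) 0) => ?; case: (leP (- k) 0) => ?; nra.
exists 0.
have -> : \int[mu]_(x in `[c, d]) (phi x - 0) ^+ 2 = \int[mu]_(x in `[c, d]) phi x ^+ 2.
  by apply: eq_Rintegral => x _; rewrite subr0.
have icd := integrable_seg_sub ac db iphi.2.
have cbL : c <= b - L by exact: le_trans (ltW caL) aLb.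
rewrite (Rintegral_seg_split cbL (ltW dbL) icd).
have icb := integrable_seg_sub (lexx c) (ltW dbL) icd.
rewrite (Rintegral_seg_split (ltW caL) aLb icb).
rewrite int_sq_l// int_sq_m int_sq_r//.
(* Cutting (a, c) off takes (c - a) ((lu c - 1)^2 + 1) >= 2 (c - a) off the
   integral, because lu c <= 0; likewise at d. *)
have h1 : 0 <= (c - a) * (lu c - 1) ^+ 2 - (c - a).
  have lc : lu c <= 0 by apply: ln_le0; rewrite ler_pdivrMr//; lra.
  rewrite subr_ge0 ler_peMr ?subr_ge0//; nra.
have h2 : 0 <= (b - d) * (lv d - 1) ^+ 2 - (b - d).
  have lc : lv d <= 0 by apply: ln_le0; rewrite ler_pdivrMr//; lra.
  rewrite subr_ge0 ler_peMr ?subr_ge0//; nra.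
by have := hL; move: h1 h2; set X := (lu c - 1) ^+ 2; set Y := (lv d - 1) ^+ 2; lra.
Qed.

Lemma two_sided_log_exp t : 0 <= t < 1 ->
  mu.-integrable (`[a, b] : set R) (EFin \o (fun x => expR `|t * phi x|)) /\
  seg_mean a b (fun x => expR `|t * phi x|) = (1 - t / 2) / (1 - t).
Proof.
move=> /andP[t0 t1].
have [iu _] := FTC_ln_exp s1 L0 ab (upos (lexx a)) (u0 (lexx a)) (u0 (ltW ab)) t1.
have [iv _] := FTC_ln_exp s2 L0 ab (vpos (lexx b)) (v0 (ltW ab)) (v0 (lexx b)) t1.
have phi_exp x : expR `|t * phi x| <= expR (- t * lu x) + expR (- t * lv x) + 1.
  have e1 := expR_ge0 (- t * lu x); have e2 := expR_ge0 (- t * lv x).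
  have [xb|xb] := leP x (b - L).
    rewrite phi_u// /logp -/(lu x); case: (leP (- lu x) 0) => h.
      by rewrite mulr0 normr0 expR0; lra.
    by rewrite ger0_norm ?mulr_ge0 ?(ltW h)// mulrN -mulNr; lra.
  rewrite phi_v; last by have := hL; have := L0; lra.
  rewrite /logp -/(lv x); case: (leP (- lv x) 0) => h.
    by rewrite oppr0 mulr0 normr0 expR0; lra.
  by rewrite mulrN normrN ger0_norm ?mulr_ge0 ?(ltW h)// mulrN -mulNr; lra.
have ie : mu.-integrable (`[a, b] : set R) (EFin \o (fun x => expR `|t * phi x|)).
  refine (le_integrable _ _ _ (integrableD _ (integrableD _ iu iv)
    (integrable_cst_seg a b 1))) => //.
    apply/measurable_EFinP; apply: (measurableT_comp (f := @expR R)).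
      exact: measurable_expR.
    by apply: measurableT_comp => //; apply: measurable_funM => //; exact: measurable_funTS.
  move=> x _ /=; rewrite lee_fin ger0_norm ?expR_ge0//.
  by rewrite (le_trans (phi_exp x))// ler_norm.
split => //; rewrite /seg_mean split3//.
have -> : \int[mu]_(x in `[a, a + L]) expR `|t * phi x| =
    \int[mu]_(x in `[a, a + L]) expR (- t * lu x).
  apply: eq_Rintegral => x; rewrite inE /= in_itv /= => /andP[ax xa].
  have lx : lu x <= 0 by apply: ln_le0; rewrite ler_pdivrMr//; lra.
  by rewrite phi_l// ger0_norm ?mulr_ge0 ?oppr_ge0// mulrN -mulNr.
have -> : \int[mu]_(x in `[b - L, b]) expR `|t * phi x| =
    \int[mu]_(x in `[b - L, b]) expR (- t * lv x).
  apply: eq_Rintegral => x; rewrite inE /= in_itv /= => /andP[ax xa].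
  have lx : lv x <= 0 by apply: ln_le0; rewrite ler_pdivrMr//; lra.
  by rewrite phi_r// ler0_norm ?mulr_ge0_le0// -mulNr.
have -> : \int[mu]_(x in `[a + L, b - L]) expR `|t * phi x| =
    \int[mu]_(x in `[a + L, b - L]) 1.
  apply: eq_Rintegral => x; rewrite inE /= in_itv /= => /andP[h1 h2].
  by rewrite phi_m// mulr0 normr0 expR0.
have [_] := FTC_ln_exp s1 L0 aL' (upos (lexx a)) (u0 (lexx a)) (u0 aL) t1.
rewrite -!/(lu _) lu1 => ->.
have [_] := FTC_ln_exp s2 L0 Lb' (vpos (lexx b)) (v0 Lb) (v0 (lexx b)) t1.
rewrite -!/(lv _) lv1 => ->.
rewrite Rintegral_seg_cst// mulr0 expR0 !subrr !mul0r -hL.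
have h : (1 - t) * (1 - t)^-1 = 1 by rewrite divff// gt_eqF// subr_gt0.
have hi : (4 * L) * (4 * L)^-1 = 1 by rewrite divff// gt_eqF// mulr_gt0.
have hbL : b - L - (a + L) = 2 * L by have := hL; lra.
have haL : a + L - a = L by lra.
have hbL' : b - L - b = - L by lra.
rewrite haL hbL hbL'; move: h hi; set j := (1 - t)^-1; set i := (4 * L)^-1 => h hi.
have -> : (1 - t / 2) * j = (4 * L * i) * (1 - t / 2) * j by rewrite hi mul1r.
have -> : i * (L * (1 * j) - 0 + (1 * (2 * L) + (0 - - L * (1 * j)))) =
  i * (L * j * 2 + 2 * L * ((1 - t) * j)) by rewrite h; lra.
by lra.
Qed.

End Example.

(** * Multiples of the two-sided logarithm *)

Section Extremal.
Context {R : realType}.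
Implicit Types (a b c d t : R) (phi : R -> R).

Lemma sq_integrable_scale a b t phi : sq_integrable a b phi ->
  sq_integrable a b (fun x => t * phi x).
Proof.
move=> [mphi iphi]; split; first exact: measurable_funM.
have -> : (fun x => (t * phi x) ^+ 2) = (fun x => t ^+ 2 * phi x ^+ 2).
  by apply/funext => x; rewrite exprMn.
exact: (integrableZl _ (t ^+ 2) iphi).
Qed.

Lemma mean_scale a b t phi : mu.-integrable (`[a, b] : set R) (EFin \o phi) ->
  seg_mean a b (fun x => t * phi x) = t * seg_mean a b phi.
Proof. by move=> iphi; rewrite /seg_mean RintegralZl// mulrCA. Qed.

Lemma variance_scale a b t phi : sq_integrable a b phi ->
  seg_variance a b (fun x => t * phi x) = t ^+ 2 * seg_variance a b phi.
Proof.
move=> iphi; have i1 := sq_integrable_id iphi (lexx a) (lexx b).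
rewrite /seg_variance mulrBr -exprMn -(mean_scale t i1); congr (_ - _).
rewrite -(mean_scale _ iphi.2).
by congr (seg_mean _ _ _); apply/funext => x; rewrite exprMn.
Qed.

Lemma sq_integrable_sub a b c d phi : a <= c -> d <= b ->
  sq_integrable a b phi -> sq_integrable c d phi.
Proof.
move=> ac db iphi; split; last exact: integrable_seg_sub ac db iphi.2.
by apply: measurable_funS iphi.1 => //; apply: subset_itv; rewrite bnd_simp.
Qed.

Variables (Q : set R) (a b : R).
Hypothesis Qi : bdd_interval Q.
Hypothesis ab : a < b.
Hypothesis Qab : has_endpoints Q a b.
Let phi t (x : R) := t * two_sided_log a b x.

Let ilog := two_sided_log_sq_integrable ab.
Let iphi t := sq_integrable_scale t ilog.
Let i1 t := sq_integrable_id (iphi t) (lexx a) (lexx b).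

(** All variances are at most t^2, with equality on Q itself. *)
Lemma extremal_norm t : 0 <= t -> bmo_norm Q (phi t) = t%:E.
Proof.
move=> t0; apply/eqP; rewrite eq_le; apply/andP; split.
  apply: (bmo_norm_le Qab t0) => c d ac cd db.
  have icd := sq_integrable_sub ac db ilog.
  split; first exact: sq_integrable_scale.
  rewrite variance_scale//; apply: ler_piMr; first exact: sqr_ge0.
  have [k Hk] := two_sided_log_osc ab ac cd db.
  have := le_trans (variance_le k cd icd) Hk.
  by rewrite -[X in _ <= X]mul1r ler_pM2r// subr_gt0.
apply: le_trans (bmo_norm_ge (phi t) Qi).
rewrite (mean_oscillation_endpoints ab Qab (iphi t)) lee_fin.
by rewrite variance_scale// two_sided_log_variance// mulr1 sqrtr_sqr ger0_norm.
Qed.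

Lemma extremal_BMO t : 0 <= t -> BMO Q (phi t).
Proof.
move=> t0; split; last by rewrite extremal_norm// ltry.
apply: integrableS (i1 t) => //; first exact: measurable_endpoints Qab.
exact: (has_endpoints_sub Qab).2.
Qed.

Lemma extremal_exp_avg t : exp_avg Q (phi t) =
  (((b - a)^-1)%:E * \int[mu]_(x in `[a, b]) (expR `|phi t x|)%:E)%E.
Proof.
rewrite /exp_avg (avg_Rintegral ab Qab (i1 t)) /= mean_scale; last first.
  exact: sq_integrable_id ilog (lexx a) (lexx b).
rewrite (two_sided_log_mean ab) mulr0 (avg_endpoints ab Qab).
  by congr (_ * _)%E; apply: eq_integral => x _; rewrite subr0.
apply: (measurableT_comp (f := @expR R)); first exact: measurable_expR.
apply: measurableT_comp => //; apply: measurable_funB => //; exact: (iphi t).1.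
Qed.

Lemma extremal_exp_avg_lt1 t : 0 <= t < 1 ->
  exp_avg Q (phi t) = ((1 - t / 2) / (1 - t))%:E.
Proof.
move=> t01; have [ie me] := two_sided_log_exp ab t01.
by rewrite extremal_exp_avg EFin_Rintegral// -me.
Qed.

(** The average increases with t, and for t < 1 its value (1 - t / 2) / (1 - t)
is unbounded. *)
Lemma extremal_exp_avg1 : exp_avg Q (phi 1) = +oo%E.
Proof.
have mexp t : measurable_fun (`[a, b] : set R) (fun x => (expR `|phi t x|)%:E).
  apply/measurable_EFinP; apply: (measurableT_comp (f := @expR R)).
    exact: measurable_expR.
  by apply: measurableT_comp => //; exact: (iphi t).1.
have mono t : 0 <= t < 1 -> (((1 - t / 2) / (1 - t))%:E <= exp_avg Q (phi 1))%E.
  move=> t01; rewrite -(extremal_exp_avg_lt1 t01) (extremal_exp_avg t) (extremal_exp_avg 1).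
  rewrite lee_pmul2l ?lte_fin ?invr_gt0 ?subr_gt0//.
  apply: ge0_le_integral => //.
  - exact: mexp.
  - exact: mexp.
  move=> x _; rewrite lee_fin ler_expR /phi mul1r normrM.
  by move/andP : t01 => [t0 /ltW t1]; rewrite (ger0_norm t0) ler_piMl.
apply/eqyP => A A0.
(* At t = 1 - w the value is (1 + w) (A + 1). *)
pose w := (2 * (A + 1))^-1.
have A1 : 0 < 2 * (A + 1) by lra.
have wA : w * (2 * (A + 1)) = 1 by rewrite mulVf// gt_eqF.
have w0 : 0 < w by rewrite invr_gt0.
have w1 : w <= 1 by rewrite -wA ler_peMr ?(ltW w0)//; lra.
apply: le_trans (mono (1 - w) _); last by apply/andP; split; lra.
rewrite lee_fin (_ : 1 - (1 - w) = w); last by lra.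
rewrite ler_pdivlMr//; move: wA; set B := w * A => wA.
have -> : A * w = 1 / 2 - w by lra.
by lra.
Qed.

End Extremal.

Theorem theorem2p5 (R : realType) (Q : set R) (hQ : bdd_interval Q) :
  [/\ (exists C : R -> R,
         (forall eps : R, 0 <= eps < 1 -> 1 <= C eps) /\
         (forall phi : R -> R, BMO Q phi -> (bmo_norm Q phi < 1)%E ->
            (exp_avg Q phi <= (C (fine (bmo_norm Q phi)))%:E)%E)),
      (exists phi : R -> R,
         [/\ BMO Q phi, bmo_norm Q phi = 1%E & exp_avg Q phi = +oo%E]) &
      (forall eps : R, 0 <= eps < 1 ->
         (((1 - eps / 2) / (1 - eps))%:E <= best_const Q eps)%E /\
         (best_const Q eps <= ((1 - eps ^+ 2 / 2) / (1 - eps))%:E)%E)].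
Proof.
have [a [b [ab Qab]]] := bdd_interval_endpoints hQ.
split.
- exists (fun eps => (1 - eps ^+ 2 / 2) / (1 - eps)); split.
    move=> eps /andP[eps0 eps1].
    by rewrite ler_pdivlMr ?subr_gt0// mul1r; nra.
  move=> phi Qphi norm1.
  have fnorm : bmo_norm Q phi \is a fin_num.
    by rewrite ge0_fin_numE ?bmo_norm_ge0// (lt_trans norm1) ?ltry.
  apply: exp_avg_le => //; last by rewrite fineK.
  by rewrite -lee_fin -lte_fin fineK// bmo_norm_ge0.
- exists (fun x => 1 * two_sided_log a b x); split.
  + exact: extremal_BMO.
  + exact: extremal_norm.
  + exact: extremal_exp_avg1.
move=> eps eps01; have /andP[eps0 _] := eps01; split.
  apply: ereal_sup_ubound; exists (fun x => eps * two_sided_log a b x).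
    by split; [exact: extremal_BMO|exact: extremal_norm].
  exact: extremal_exp_avg_lt1.
apply: ge_ereal_sup => _ [phi [Qphi norm_phi] <-].
by apply: exp_avg_le; rewrite ?norm_phi.
Qed.
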